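(* Let $\Delta>-1$ and let $(X_n)_{n\ge 0}$ be the vertex-reinforced random walk (VRRW) on $\mathbb{Z}$ with weight function $W(n)=n+\Delta$, started at some $v_0\in\mathbb{Z}$. Let $R'$ be the set of vertices visited infinitely often. Then $|R'|<\infty$ almost surely and, for any $x\in\mathbb{Z}$, $$\mathbb{P}\big(R'=\{x-2,x-1,x,x+1,x+2\}\big)>0.$$
   Context: For $v\in\mathbb{Z}$ and $n\in\mathbb{N}\cup\{0,\infty\}$ let $Z_n(v)=1+\sum_{k=0}^n \mathbf{1}_{\{X_k=v\}}$ (number of visits to $v$ up to time $n$, plus one), and $\mathcal{F}_n=\sigma(X_0,\dots,X_n)$. The VRRW on $\mathbb{Z}$ (nearest-neighbour graph, all propensities equal to $1$) with weight $W(n)=n+\Delta$, $\Delta>-1$, started at $v_0$, is the process with $X_0=v_0$ and, for all $n\ge0$, on $\{X_n=i\}$, $$\mathbb{P}(X_{n+1}=i\pm1\mid\mathcal{F}_n)=\frac{Z_n(i\pm1)+\Delta}{Z_n(i-1)+Z_n(i+1)+2\Delta}.$$ The asymptotic range is $R'=\{v\in\mathbb{Z}: Z_\infty(v)=\infty\}$. *)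

(* Defs.v *)
From HB Require Import structures.
From mathcomp Require Import all_boot all_order all_algebra.
From mathcomp Require Import all_classical all_reals all_analysis.
Set Implicit Arguments.
Unset Strict Implicit.
Unset Printing Implicit Defensive.
Import Order.TTheory GRing.Theory Num.Theory.
Local Open Scope classical_set_scope.
Local Open Scope ring_scope.

HB.instance Definition _ := isPointed.Build int 0.
HB.instance Definition _ := @isMeasurable.Build default_measure_display
  int (@discrete_measurable int) (@discrete_measurable0 int)
  (@discrete_measurableC int) (@discrete_measurableU int).

Definition natural_filtration (T : Type) (X : nat -> T -> int) (n : nat) :
    set (set T) :=
  g_sigma_preimage (fun k : 'I_n.+1 => X k).

(* Y is a version of P(E | G). Since <<s G>> = G for a sigma-algebra G, the
   first condition is the G-measurability of Y. *)
Definition is_cond_prob (R : realType) (d : measure_display)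
    (T : measurableType d) (P : probability T R) (G : set (set T)) (E : set T)
    (Y : T -> R) : Prop :=
  [/\ measurable_fun [set: g_sigma_algebraType G]
        (Y : g_sigma_algebraType G -> R),
      P.-integrable [set: T] (EFin \o Y) &
      forall A, G A -> (\int[P]_(w in A) (Y w)%:E = P (A `&` E))%E].

Definition visits (T : Type) (X : nat -> T -> int) (n : nat) (v : int)
    (w : T) : nat :=
  (1 + \sum_(k < n.+1) (X k w == v))%N.

Definition total_visits (R : realType) (T : Type) (X : nat -> T -> int)
    (v : int) (w : T) : \bar R :=
  (1 + \sum_(0 <= k <oo) ((X k w == v)%:R : R)%:E)%E.

Definition asymptotic_range (R : realType) (T : Type) (X : nat -> T -> int)
    (w : T) : set int :=
  [set v | total_visits R X v w = +oo%E].

(* Vertex-reinforced random walk on the integers with weight n |-> n + Delta,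
   started at v0. *)
Definition vrrw (R : realType) (d : measure_display) (T : measurableType d)
    (P : probability T R) (Delta : R) (v0 : int)
    (X : nat -> {RV P >-> int}) : Prop :=
  {ae P, forall w, X 0%N w = v0} /\
  forall (n : nat) (i j : int), j = i - 1 \/ j = i + 1 ->
    exists Y : T -> R,
      is_cond_prob P (natural_filtration X n) [set w | X n.+1 w = j] Y /\
      {ae P, forall w, X n w = i ->
         Y w = ((visits X n j w)%:R + Delta) /
               ((visits X n (i - 1) w)%:R + (visits X n (i + 1) w)%:R
                + 2 * Delta)}.

(* Main.v *)
Require Import Defs.
From HB Require Import structures.
From mathcomp Require Import all_boot all_order all_algebra.
From mathcomp Require Import all_classical all_reals all_analysis.
From mathcomp Require Import ring lra zify.
Set Implicit Arguments.
Unset Strict Implicit.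
Unset Printing Implicit Defensive.
Import Order.TTheory GRing.Theory Num.Theory.
Local Open Scope classical_set_scope.
Local Open Scope ring_scope.

(* Write w(v) for 1 + Delta plus the number of visits to v. Around a site x put
   a = w(x+1), c = w(x+2) and let y <= w(x-1) count the steps from x to x-1.
   Counting visits to x shows that from x+1 the walk steps to x+2 with
   probability at most c / (a + y), and from x it steps to x+1 with probability
   at most a / (a + y). Hence the Polya urn martingale
   a (a+1) / ((a+y) (a+y+1)) plus a multiple of c / a is a supermartingale as
   long as a / (a + y) stays below a threshold be < 1, and it bounds the
   probability that the walk ever reaches x+3 or breaks the threshold.
   - With be small this gives, at the first visit to any new site m, a
     probability at most k < 1, uniform in the past, of ever reaching m+3. So
     the range is bounded almost surely.
   - With be = 9/10, after many turns around x, both sides have probability at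
     most 9/20 of being broken, so with positive probability the walk stays in
     [x-2, x+2] with w(x-1) and w(x+1) comparable. Then x-1, x and x+1 are
     visited infinitely often, and so are x-2 and x+2 because w(x+1) must
     diverge while each visit to x+1 leads to x+2 with probability of order
     1 / w(x+1).
   Paths are lists in reverse order: the current position is the head. *)

(** * Urn inequalities *)

Section Urn.
Variable R : realFieldType.
Implicit Types a y be : R.

(** In a Polya urn with [a] and [y] balls, the probability that the next two draws both have the
    first colour: the second moment of the limiting Beta proportion, hence a martingale. *)
Definition urn a y : R := a * (a + 1) / ((a + y) * (a + y + 1)).

Lemma urn_ge0 a y : 0 < a -> 0 < y -> 0 <= urn a y.
Proof. by move=> a0 y0; apply: divr_ge0; nra. Qed.

(** If [a / (a + y)] exceeds [be], so does [(a + 1) / (a + y + 1)], and [urn] is their product. *)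
Lemma urn_gt a y be : 0 < a -> 0 < y -> 0 < be -> be * (a + y) < a ->
  be ^+ 2 <= urn a y.
Proof.
move=> a0 y0 b0 h; rewrite /urn ler_pdivlMr; last nra.
have h1 : be * (a + y + 1) <= a + 1.
  have : be < 1 by nra.
  nra.
have -> : be ^+ 2 * ((a + y) * (a + y + 1)) =
    (be * (a + y)) * (be * (a + y + 1)) by ring.
apply: ler_pM; nra.
Qed.

(** Equality holds at [q = a / (a + y)], and the left side increases with [q] because
    [urn a (y + 1) <= urn (a + 1) y]. *)
Lemma urn_step a y q : 0 < a -> 0 < y -> 0 <= q -> q <= a / (a + y) ->
  q * urn (a + 1) y + (1 - q) * urn a (y + 1) <= urn a y.
Proof.
move=> a0 y0 q0 hq.
have e : a / (a + y) * urn (a + 1) y + (1 - a / (a + y)) * urn a (y + 1)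
    = urn a y.
  rewrite /urn; field; repeat (apply/andP; split); lra.
have h : urn a (y + 1) <= urn (a + 1) y.
  rewrite /urn; have -> : a + (y + 1) = a + 1 + y by ring.
  rewrite ler_pM2r ?invr_gt0; nra.
nra.
Qed.

(** The price of a visit to [x + 1] coming from [x + 2]: it raises [a] without being a draw made at
    [x]. *)
Lemma urn_incr a y : 1 <= a -> 0 < y ->
  urn (a + 1) y - urn a y <= 4 * a / (a + y) ^+ 2.
Proof.
move=> a0 y0; have s0 : 0 < a + y by lra.
have -> : urn (a + 1) y - urn a y =
    2 * (a + 1) * y / ((a + y) * (a + y + 1) * (a + y + 2)).
  rewrite /urn; field; repeat (apply/andP; split); lra.
rewrite ler_pdivlMr; last by nra.
rewrite mulrAC ler_pdivrMr; last by nra.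
rewrite -subr_ge0.
have -> : 4 * a * ((a + y) * (a + y + 1) * (a + y + 2))
    - 2 * (a + 1) * y * (a + y) ^+ 2 =
  (a + y) * (4 * a * ((a + y + 1) * (a + y + 2)) - 2 * (a + 1) * y * (a + y))
  by ring.
apply: mulr_ge0; first lra.
have : (a + 1) * (y * (a + y)) <= (2 * a) * ((a + y + 1) * (a + y + 2)).
  apply: ler_pM; nra.
nra.
Qed.

(** The balance at [x + 1], where [a] counts the present visit and [a - 1] does not. A step to
    [x + 2] costs at most [4 / a] in the urn term, [th / a] for the danger of reaching [x + 3] and
    [K / a] for the growth of [c]. The drop from [K * (c / (a - 1))] to [K * (c / a)] pays for it,
    since the choice of [K] means [K = be * (4 + th + K)]. *)
Lemma neighbour_step a y be c th K q : 0 < be -> be < 1 -> 0 <= th ->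
  K * (1 - be) = be * (4 + th) -> 1 < a -> 0 < y -> a <= be * (a + y) ->
  0 < c -> 0 <= q -> q <= c / (a + y) ->
  q * (urn (a + 1) y / be ^+ 2 + K * ((c + 1) / a) + th / a)
  + (1 - q) * (urn a y / be ^+ 2 + K * (c / a))
  <= urn a y / be ^+ 2 + K * (c / (a - 1)).
Proof.
move=> be0 be1 th0 hK a1 y0 has c0 q0 hq.
have s0 : 0 < a + y by lra.
have K0 : 0 <= K by nra.
have b2 : 0 < be ^+ 2 by rewrite exprn_gt0.
have D : (urn (a + 1) y - urn a y) / be ^+ 2 <= 4 / a.
  rewrite ler_pdivrMr //; apply: le_trans (urn_incr (ltW a1) y0) _.
  rewrite ler_pdivrMr ?exprn_gt0 // -mulrA mulrAC ler_pdivlMr; last lra.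
  have : a * a <= (be * (a + y)) * (be * (a + y)) by apply: ler_pM; lra.
  rewrite !expr2; nra.
have hq2 : q <= c * be / a.
  apply: le_trans hq _; rewrite ler_pdivrMr // mulrAC ler_pdivlMr; last lra.
  nra.
have ea : (c + 1) / a = c / a + 1 / a by rewrite mulrDl.
have E : K * (c / (a - 1)) - K * (c / a) = c * K / (a * (a - 1)).
  by field; apply/andP; split; lra.
have M : q * (4 / a + th / a + K * (1 / a)) <= c * K / (a * (a - 1)).
  apply: (@le_trans _ _ (c * be / a * (4 / a + th / a + K * (1 / a)))).
    apply: ler_wpM2r => //.
    have ia : 0 <= a^-1 by rewrite invr_ge0; lra.
    rewrite mul1r; nra.
  have -> : c * be / a * (4 / a + th / a + K * (1 / a)) = c * K / (a * a).
    have hK' : be * (4 + th + K) = K by lra.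
    by rewrite -[in RHS]hK'; field; lra.
  apply: ler_wpM2l; first by nra.
  rewrite lef_pV2 ?posrE; nra.
have := ler_wpM2l q0 D.
rewrite mulrBl ea.
move: (urn (a + 1) y / _) (urn a y / _) => u v.
set ia := c / a in E *; set ja := c / (a - 1) in E *.
nra.
Qed.
End Urn.

(** * The transition kernel on reversed paths *)

Section Kernel.
Variables (R : realFieldType) (Delta : R).
Hypothesis hD : -1 < Delta.
Implicit Types (g : seq int) (B : pred (seq int)) (x v : int) (n : nat).

Definition weight g v : R := (1 + count_mem v g)%:R + Delta.

Definition step (e : int) g : seq int := head 0 g + e :: g.

Definition pstep (e : int) g : R :=
  weight g (head 0 g + e) / (weight g (head 0 g - 1) + weight g (head 0 g + 1)).

(** The probability that the walk with past [g] satisfies [B] now or within [n] further steps, by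
    first-step recursion. *)
Fixpoint hit B n g : R :=
  if B g then 1
  else if n is n'.+1 then
    pstep 1 g * hit B n' (step 1 g) + pstep (-1) g * hit B n' (step (-1) g)
  else 0.

Lemma weight_cons z g v : weight (z :: g) v = weight g v + (z == v)%:R.
Proof. by rewrite /weight /= (addnC (z == v)) addnA natrD addrAC. Qed.

Lemma weight_ge g v : 1 + Delta <= weight g v.
Proof. by rewrite /weight natrD addrAC lerDl ler0n. Qed.

Lemma weight_gt0 g v : 0 < weight g v.
Proof. by apply: lt_le_trans (weight_ge g v); rewrite -ltrBlDl sub0r. Qed.

Lemma pstep_gt0 e g : 0 < pstep e g.
Proof.
exact: divr_gt0 (weight_gt0 _ _) (addr_gt0 (weight_gt0 _ _) (weight_gt0 _ _)).
Qed.

Lemma pstepE g : pstep (-1) g = 1 - pstep 1 g.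
Proof.
rewrite /pstep.
have := weight_gt0 g (head 0 g - 1); have := weight_gt0 g (head 0 g + 1).
by move=> h1 h2; field; lra.
Qed.

Lemma pstep_lt1 g : pstep 1 g < 1.
Proof. by have := pstep_gt0 (-1) g; rewrite pstepE; lra. Qed.

Lemma hit_le1 B n g : hit B n g <= 1.
Proof.
elim: n g => [|n IH] g /=; case: ifP => // _.
have := pstep_gt0 1 g; have := pstep_lt1 g; rewrite pstepE.
have := IH (step 1 g); have := IH (step (-1) g); nra.
Qed.

Lemma sub_hit B B' n g : subpred B B' -> hit B n g <= hit B' n g.
Proof.
move=> sB; elim: n g => [|n IH] g /=; case: ifP => [/sB -> //|_].
  by case: ifP.
case: ifP => _.
  have := pstep_gt0 1 g; have := pstep_lt1 g; rewrite pstepE.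
  have := hit_le1 B n (step 1 g); have := hit_le1 B n (step (-1) g); nra.
by apply: lerD; apply: ler_wpM2l; rewrite ?(ltW (pstep_gt0 _ _)).
Qed.

Lemma count_map_opp g v : count_mem v (map -%R g) = count_mem (- v) g.
Proof. by rewrite count_map; apply: eq_count => z /=; rewrite eqr_oppLR. Qed.

Lemma weight_map_opp g v : weight (map -%R g) v = weight g (- v).
Proof. by rewrite /weight count_map_opp. Qed.

(** The kernel is invariant under reflection at 0, so every estimate to the right also serves to the
    left. *)
Lemma hit_map_opp B n g : hit (B \o map -%R) n g = hit B n (map -%R g).
Proof.
have hN h : head 0 (map -%R h) = - head 0 h :> int.
  by case: h => //=; rewrite oppr0.
have sN e h : map -%R (step e h) = step (- e) (map -%R h).
  by rewrite /step /= hN opprD.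
have pN e h : pstep (- e) (map -%R h) = pstep e h.
  rewrite /pstep !weight_map_opp !hN; congr (_ / _).
    by rewrite opprD !opprK.
  by rewrite addrC !opprD !opprK.
elim: n g => [|n IH] g //=.
rewrite !IH !sN -(pN 1) -(pN (-1)) opprK.
by case: ifP => // _; rewrite addrC.
Qed.

(* [V] relates a path to the values of a potential there: the existential
   auxiliary data of a supermartingale are hidden in [V]. *)
Lemma hit_le_potential (V : seq int -> R -> Prop) B :
  (forall g u, V g u -> 0 <= u) ->
  (forall g u, V g u -> 1 <= u \/
     ~~ B g /\ exists u1 u2, [/\ V (step 1 g) u1, V (step (-1) g) u2 &
       pstep 1 g * u1 + pstep (-1) g * u2 <= u]) ->
  forall n g u, V g u -> hit B n g <= u.
Proof.
move=> V0 VS; elim=> [|n IH] g u Vu; case: (VS _ _ Vu) => [u1|[nB]].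
- exact: le_trans (hit_le1 _ _ _) u1.
- by move=> _ /=; rewrite (negbTE nB); exact: V0 Vu.
- exact: le_trans (hit_le1 _ _ _) u1.
move=> [u1 [u2 [Vu1 Vu2 le_u]]] /=; rewrite (negbTE nB).
apply: le_trans le_u; apply: lerD; apply: ler_wpM2l;
  by [exact: ltW (pstep_gt0 _ _)|exact: IH].
Qed.

(** Strong Markov property at the first time in [B]: the invariant [S] excludes [B'] before that
    time, and from then on [B'] has probability at most [k]. *)
Lemma hit_mul (S B B' : pred (seq int)) (k : R) :
  (forall g, S g -> B g -> forall n, hit B' n g <= k) ->
  (forall g, S g -> ~~ B g -> [&& ~~ B' g, S (step 1 g) & S (step (-1) g)]) ->
  forall n g, S g -> hit B' n g <= k * hit B n g.
Proof.
move=> SB SN; elim=> [|n IH] g Sg.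
  case Bg: (B g); first by rewrite /= Bg mulr1; exact: (SB _ Sg Bg 0%N).
  have /and3P[/negbTE /= -> _ _] := SN _ Sg (negbT Bg).
  by rewrite Bg mulr0.
case Bg: (B g); first by rewrite [hit B _ _]/= Bg mulr1; exact: SB.
have /and3P[/negbTE /= -> S1 S2] := SN _ Sg (negbT Bg).
rewrite Bg mulrDr !(mulrCA k); apply: lerD; apply: ler_wpM2l;
  by [exact: ltW (pstep_gt0 _ _)|exact: IH].
Qed.

Lemma head_step e g : head 0 (step e g) = head 0 g + e.
Proof. by []. Qed.

Lemma weight_step_eq e g : weight (step e g) (head 0 g + e) =
  weight g (head 0 g + e) + 1.
Proof. by rewrite weight_cons eqxx. Qed.

Lemma weight_step_neq e g v : head 0 g + e != v ->
  weight (step e g) v = weight g v.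
Proof. by rewrite weight_cons => /negbTE->; rewrite addr0. Qed.

Lemma le_weight_step e g v : weight g v <= weight (step e g) v.
Proof. by rewrite weight_cons lerDl ler0n. Qed.

(** For [rho = be / (1 - be)] the second alternative says that [x + 1] holds more than the fraction
    [be] of the joint weight of [x - 1] and [x + 1]. *)
Definition escape (rho : R) x : pred (seq int) := fun g =>
  (x + 3 <= head 0 g) || (rho * weight g (x - 1) < weight g (x + 1)).

Local Ltac ilia :=
  repeat match goal with H : context [R] |- _ => clear H end; lia.

(** * A supermartingale against escape to the right *)

Section OneSided.
Variables (be th : R) (x : int).
Hypotheses (be0 : 0 < be) (be1 : be < 1) (th0 : 0 <= th).

Let K := be * (4 + th) / (1 - be).
Let a g := weight g (x + 1).
Let b g := weight g x.
Let c g := weight g (x + 2).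

(* [y] is a lower bound for the weight of [x - 1] which counts the steps from
   [x] to [x - 1], so that every visit to [x] is accounted for by [a + y - c].
*)
Let potential g (u : R) := 0 <= u /\ (1 <= u \/ exists y,
  [/\ 0 < y, y <= weight g (x - 1), weight g (x + 3) <= th &
  [\/ [/\ head 0 g <= x, a g + y + (head 0 g == x)%:R <= b g + c g &
        urn (a g) y / be ^+ 2 + K * (c g / a g) <= u],
      [/\ head 0 g = x + 1, 1 < a g, a g + y <= b g + c g &
        urn (a g) y / be ^+ 2 + K * (c g / (a g - 1)) <= u] |
      [/\ head 0 g = x + 2, a g + y + 1 <= b g + c g &
        urn (a g + 1) y / be ^+ 2 + K * (c g / a g) + th / a g <= u]]]).

Let K0 : 0 <= K.
Proof.
have [hb0 hb1 ht0] := And3 be0 be1 th0.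
by apply: divr_ge0; [apply: mulr_ge0; lra|lra].
Qed.

Let be2 : 0 < be ^+ 2. Proof. exact: exprn_gt0. Qed.

Let urn_large (w z y : R) : 0 < w -> 0 < y -> 0 <= z -> be * (w + y) < w ->
  1 <= urn w y / be ^+ 2 + z.
Proof.
move=> w0 y0 z0 h; apply: le_trans (_ : urn w y / be ^+ 2 <= _).
  by rewrite ler_pdivlMr // mul1r urn_gt.
by rewrite lerDl.
Qed.

Let value_ge0 (w y u z : R) : 0 < w -> 0 < y -> 0 < u -> 0 < z ->
  0 <= urn w y / be ^+ 2 + K * (u / z).
Proof.
move=> w0 y0 u0 z0; apply: addr_ge0.
  by apply: divr_ge0; [exact: urn_ge0|exact: ltW].
by apply: mulr_ge0 => //; apply: divr_ge0; exact: ltW.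
Qed.

Let not_escape g y : head 0 g < x + 3 -> 0 < y -> y <= weight g (x - 1) ->
  a g <= be * (a g + y) -> ~~ escape (be / (1 - be)) x g.
Proof.
have [hb0 hb1 ht0] := And3 be0 be1 th0.
move=> hx y0 hy ha; rewrite negb_or -ltNge hx -leNgt /= mulrAC.
rewrite ler_pdivlMr; last by lra.
have := ler_wpM2l (ltW be0) hy; rewrite -/(a g); lra.
Qed.

(** The cases follow the position. At [x] the walk draws from the urn; at [x + 1] it satisfies
    [neighbour_step]; at [x + 2] the urn term already counts the return to [x + 1], and [th / a]
    covers a step to [x + 3]. *)
Let potential_step g u : potential g u -> 1 <= u \/
  ~~ escape (be / (1 - be)) x g /\ exists u1 u2,
    [/\ potential (step 1 g) u1, potential (step (-1) g) u2 &
     pstep 1 g * u1 + pstep (-1) g * u2 <= u].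
Proof.
have [hb0 hb1 ht0] := And3 be0 be1 th0.
case=> u0 [|[y [y0 hy hth]]]; first by left.
have a0 : 0 < a g by exact: weight_gt0.
have b0 : 0 < b g by exact: weight_gt0.
have c0 : 0 < c g by exact: weight_gt0.
case=> -[].
- move=> hx hI hu.
  (* Once the threshold [be] is broken, the urn term alone is at least 1. *)
  have [ha|ha] := leP (a g) (be * (a g + y)); last first.
    left; apply: le_trans hu; apply: urn_large => //.
    by rewrite mulr_ge0 // divr_ge0 // ltW.
  right; split; first by apply: (not_escape _ y0 hy ha); ilia.
  have aD e : head 0 g + e <= x -> a (step e g) = a g.
    by move=> h; apply: weight_step_neq; ilia.
  have cD e : head 0 g + e <= x + 1 -> c (step e g) = c g.
    by move=> h; apply: weight_step_neq; ilia.
  have hthD e : head 0 g + e <= x + 1 -> weight (step e g) (x + 3) <= th.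
    by move=> h; rewrite weight_step_neq //; ilia.
  have hyD e : y <= weight (step e g) (x - 1).
    exact: le_trans hy (le_weight_step _ _ _).
  (* From the left of [x], no step changes [a], [c] or [y], so [u] is kept; an arrival at [x] adds
     one to [b], which pays for the indicator. *)
  move: hx; rewrite le_eqVlt => /orP[/eqP hx|hx]; last first.
    have pot e : (e == 1) || (e == -1) -> potential (step e g) u.
      move=> he; split=> //; right; exists y; split => //.
        by apply: hthD; ilia.
      constructor 1; rewrite aD ?cD; try ilia.
      rewrite head_step; split=> //; first ilia.
      rewrite (_ : head 0 g == x = false) in hI; last ilia.
      case: eqP => [E|E]; last first.
        by apply: le_trans hI _; rewrite lerD2r le_weight_step.
      rewrite {1}/b -E weight_step_eq E -/(b g) [leRHS]addrAC lerD2r.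
      by rewrite addr0 in hI.
    exists u, u; split; [exact: pot|exact: pot|].
    by rewrite pstepE; lra.
  have {}hI : a g + y + 1 <= b g + c g by move: hI; rewrite hx eqxx.
  exists (urn (a g + 1) y / be ^+ 2 + K * (c g / a g)).
  exists (urn (a g) (y + 1) / be ^+ 2 + K * (c g / a g)).
  have a1 : a (step 1 g) = a g + 1 by rewrite /a -hx weight_step_eq.
  have kc0 : 0 <= K * (c g / a g) by rewrite mulr_ge0 // divr_ge0 // ltW.
  split.
  + split.
      by apply: value_ge0 => //; lra.
    right; exists y; split=> //; first by apply: hthD; ilia.
    constructor 2; rewrite a1 cD ?hx // addrK; split=> //.
      by rewrite head_step hx.
      by lra.
    by rewrite /b weight_step_neq -/(b g); [lra|ilia].
  + split.
      by apply: value_ge0 => //; lra.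
    right; exists (y + 1); split=> //; first by lra.
    * by rewrite -{1}hx weight_step_eq hx lerD2r.
    * by apply: hthD; ilia.
    constructor 1; rewrite aD ?cD ?hx; try ilia.
    rewrite head_step; split=> //; first ilia.
    rewrite hx (_ : x + -1 == x = false) ?addr0; last ilia.
    by rewrite /b weight_step_neq -/(b g); [lra|ilia].
  + apply: le_trans hu; rewrite pstepE.
    have hp : pstep 1 g <= a g / (a g + y).
      have w0 : 0 < weight g (x - 1) + a g.
        exact: addr_gt0 (weight_gt0 _ _) _.
      rewrite /pstep hx ler_pM2l // lef_pV2 ?posrE //; last exact: addr_gt0.
      by rewrite addrC lerD2r.
    have := urn_step a0 y0 (ltW (pstep_gt0 1 g)) hp.
    move: (urn _ _) (urn _ _) (urn _ _) => z3 z2 z1 hz.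
    have : (pstep 1 g * z1 + (1 - pstep 1 g) * z2) / be ^+ 2 <= z3 / be ^+ 2.
      by rewrite ler_pM2r ?invr_gt0.
    move: (pstep 1 g) (K * _) (be ^+ 2)^-1 => p k q; lra.
- move=> hx a1 hI hu.
  have [ha|ha] := leP (a g) (be * (a g + y)); last first.
    left; apply: le_trans hu; apply: urn_large => //.
    by rewrite mulr_ge0 // divr_ge0 // ?ltW // subr_gt0.
  right; split; first by apply: (not_escape _ y0 hy ha); ilia.
  have hthD e : head 0 g + e <= x + 2 -> weight (step e g) (x + 3) <= th.
    by move=> h; rewrite weight_step_neq //; ilia.
  have hyD e : y <= weight (step e g) (x - 1).
    exact: le_trans hy (le_weight_step _ _ _).
  have aD e : e != 0 -> a (step e g) = a g.
    by move=> h; apply: weight_step_neq; ilia.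
  have kc0 : 0 <= urn (a g) y / be ^+ 2 + K * (c g / a g).
    exact: value_ge0.
  have x2 : head 0 g + 1 = x + 2 by ilia.
  have x0 : head 0 g + -1 = x by ilia.
  exists (urn (a g + 1) y / be ^+ 2 + K * ((c g + 1) / a g) + th / a g).
  exists (urn (a g) y / be ^+ 2 + K * (c g / a g)).
  have c1 : c (step 1 g) = c g + 1 by rewrite /c -x2 weight_step_eq.
  split.
  + split.
      by apply: addr_ge0; [apply: value_ge0; lra|apply: divr_ge0; lra].
    right; exists y; split=> //; first by apply: hthD; ilia.
    constructor 3; rewrite aD // c1; split=> //.
    by rewrite /b weight_step_neq -/(b g); [lra|ilia].
  + split=> //.
    right; exists y; split=> //; first by apply: hthD; ilia.
    constructor 1; rewrite aD // head_step x0 eqxx.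
    rewrite /c weight_step_neq -/(c g); last ilia.
    split=> //; rewrite /b -{1}x0 weight_step_eq x0 -/(b g) -[true%:R]/(1 : R).
    lra.
  + apply: le_trans hu; rewrite pstepE.
    (* The denominator is [b + c], at least [a + y] by the count of visits. *)
    have hp : pstep 1 g <= c g / (a g + y).
      rewrite /pstep x2 -/(c g) (_ : head 0 g - 1 = x) // -/(b g).
      by rewrite ler_pM2l // lef_pV2 ?posrE; lra.
    apply: neighbour_step => //; last exact: ltW (pstep_gt0 _ _).
    by rewrite /K divfK //; lra.
- move=> hx hI hu.
  have [ha|ha] := leP (a g) (be * (a g + y)); last first.
    left; apply: le_trans hu; rewrite -addrA; apply: urn_large; try lra.
    by apply: addr_ge0; [apply: mulr_ge0 => //|];
      apply: divr_ge0 => //; exact: ltW.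
  right; split; first by apply: (not_escape _ y0 hy ha); ilia.
  have x1 : head 0 g + -1 = x + 1 by ilia.
  have kc0 : 0 <= urn (a g + 1) y / be ^+ 2 + K * (c g / a g).
    by apply: value_ge0 => //; lra.
  (* At [x + 3] the trivial value 1 is used. *)
  exists 1, (urn (a g + 1) y / be ^+ 2 + K * (c g / a g)).
  have a1 : a (step (-1) g) = a g + 1 by rewrite /a -x1 weight_step_eq.
  split.
  + by split=> //; left.
  + split=> //; right; exists y; split=> //.
    * exact: le_trans hy (le_weight_step _ _ _).
    * by rewrite weight_step_neq //; ilia.
    have bE : b (step (-1) g) = b g by apply: weight_step_neq; ilia.
    have cE : c (step (-1) g) = c g by apply: weight_step_neq; ilia.
    by constructor 2; rewrite a1 bE cE addrK; split=> //; lra.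
  + apply: le_trans hu; rewrite mulr1 addrC; apply: lerD.
      rewrite -[leRHS]mul1r; apply: ler_wpM2r => //.
      by rewrite pstepE; have := pstep_gt0 1 g; lra.
    rewrite /pstep (_ : head 0 g + 1 = x + 3); last ilia.
    rewrite (_ : head 0 g - 1 = x + 1) // -/(a g).
    have w0 := weight_gt0 g (x + 3).
    apply: ler_pM; rewrite ?invr_ge0 ?lef_pV2 ?posrE //; lra.
Qed.

Lemma hit_escape n g y : head 0 g <= x -> 0 < y -> y <= weight g (x - 1) ->
  weight g (x + 3) <= th ->
  weight g (x + 1) + y + (head 0 g == x)%:R <= weight g x + weight g (x + 2) ->
  hit (escape (be / (1 - be)) x) n g <=
    urn (weight g (x + 1)) y / be ^+ 2
    + be * (4 + th) / (1 - be) * (weight g (x + 2) / weight g (x + 1)).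
Proof.
move=> hx y0 hy hth hI; apply: (@hit_le_potential potential) => //.
- by move=> h u [].
split; last by right; exists y; split=> //; constructor 1.
by apply: value_ge0 => //; exact: weight_gt0.
Qed.
End OneSided.
End Kernel.

(** * Hitting estimates *)

Section Estimates.
Variables (R : realType) (Delta : R).
Hypothesis hD : -1 < Delta.
Implicit Types (g : seq int) (x v : int) (n : nat).

Local Notation weight := (weight Delta).
Local Notation pstep := (pstep Delta).
Local Notation hit := (hit Delta).
Local Notation escape := (escape Delta).
Let d : R := 1 + Delta.

Local Ltac ilia :=
  repeat match goal with H : context [R] |- _ => clear H end; lia.

Let d0 : 0 < d. Proof. by have := hD; rewrite /d; lra. Qed.

Definition past x : pred (seq int) := fun g => x <= head 0 g.

Lemma weight_unvisited g v : v \notin g -> weight g v = d.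
Proof. by move=> /count_memPn; rewrite /weight /d => ->; rewrite addn0. Qed.

(* Every visit to [x] sends the walk to [x - 1] with probability at least 1/2
   while [x + 1] is unvisited; [j] such steps make [y] large. *)
Let hit_past_forced (M k : R) x : 1 / 2 <= k ->
  (forall n g y, head 0 g <= x -> M <= y -> y <= weight g (x - 1) ->
    {in [:: x + 1; x + 2; x + 3], forall v, weight g v = d} ->
    y + (head 0 g == x)%:R <= weight g x -> hit (past (x + 3)) n g <= k) ->
  forall n j g y, head 0 g <= x -> d <= y -> M <= y + j%:R ->
    y <= weight g (x - 1) ->
    {in [:: x + 1; x + 2; x + 3], forall v, weight g v = d} ->
    y + (head 0 g == x)%:R <= weight g x ->
    hit (past (x + 3)) n g <= 1 - (1 - k) / 2 ^+ j.
Proof.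
move=> k2 hM.
have k1 : k <= 1 \/ 1 < k by have [|] := leP k 1; [left|right].
case: k1 => k1; last first.
  move=> n j g y *; apply: le_trans (hit_le1 hD _ _ _) _.
  rewrite lerBrDr gerDl -[_ / _]opprK oppr_le0 -mulNr opprB.
  by rewrite divr_ge0 ?exprn_ge0 //; lra.
elim=> [|n IH] [|j] g y hx yd hj hy hw hI.
- by rewrite expr0 divr1 subKr; apply: (hM _ _ y) => //;
    rewrite addr0 in hj.
- rewrite /= /past ifF; last by apply/negbTE; rewrite -ltNge; ilia.
  rewrite subr_ge0 ler_pdivrMr ?exprn_gt0 //.
  have : 1 <= 2 ^+ j.+1 :> R by rewrite exprn_ege1 //; lra.
  lra.
- by rewrite expr0 divr1 subKr; apply: (hM _ _ y) => //;
    rewrite addr0 in hj.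
rewrite /= /past ifF -/(past _); last by apply/negbTE; rewrite -ltNge; ilia.
have hwD e : head 0 g + e <= x ->
    {in [:: x + 1; x + 2; x + 3], forall v, weight (step e g) v = d}.
  move=> h v hv; rewrite weight_step_neq ?hw //.
  by rewrite !inE in hv; ilia.
have hyD e : y <= weight (step e g) (x - 1).
  exact: le_trans hy (le_weight_step _ _ _ _).
move: hx; rewrite le_eqVlt => /orP[/eqP hx|hx]; last first.
  rewrite (_ : head 0 g == x = false) ?addr0 in hI; last ilia.
  have Hs e : (e == 1) || (e == -1) ->
      hit (past (x + 3)) n (step e g) <= 1 - (1 - k) / 2 ^+ j.+1.
    move=> he; apply: (IH _ _ y) => //; try by rewrite ?head_step; ilia.
      by apply: hwD; ilia.
    rewrite head_step; case: eqP => [E|E].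
      by rewrite -{1}E weight_step_eq E lerD2r.
    by rewrite addr0 (le_trans hI (le_weight_step _ _ _ _)).
  have := Hs 1 isT; have := Hs (-1) isT.
  have := pstep_gt0 hD 1 g; have := pstep_lt1 hD g; rewrite pstepE //.
  move: (1 - (1 - k) / _) => z; nra.
have hl : hit (past (x + 3)) n (step (-1) g) <= 1 - (1 - k) / 2 ^+ j.
  have {}hI : y + 1 <= weight g x by move: hI; rewrite hx eqxx.
  apply: (IH _ _ (y + 1)) => //.
  - by rewrite head_step; ilia.
  - by lra.
  - by move: hj; rewrite -addrA -natr1 (addrC 1).
  - by rewrite -{1}hx weight_step_eq hx lerD2r.
  - by apply: hwD; ilia.
  rewrite head_step hx (_ : x + -1 == x = false) ?addr0; last ilia.
  exact: le_trans hI (le_weight_step _ _ _ _).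
have hp : 1 / 2 <= pstep (-1) g.
  rewrite /pstep hx (hw (x + 1)) ?inE ?eqxx //.
  have : d <= weight g (x - 1) by lra.
  move: (weight _ _) => w hdw; have d0' := d0.
  by rewrite ler_pdivlMr; lra.
(* After a step to [x + 1] only the trivial bound 1 is used; this halves the gain at each forced
   step. *)
have := hit_le1 hD (past (x + 3)) n (step 1 g).
have hp1 : pstep 1 g = 1 - pstep (-1) g by rewrite pstepE // subKr.
have := pstep_gt0 hD 1 g; rewrite hp1.
have e2 : (1 - k) / 2 ^+ j.+1 = (1 - k) / 2 ^+ j / 2.
  by rewrite exprS invfM mulrA mulrAC.
have q0 : 0 <= (1 - k) / 2 ^+ j.
  by apply: divr_ge0; [lra|apply: exprn_ge0].
rewrite e2.
move: ((1 - k) / 2 ^+ j) (hit _ _ (step 1 g)) hl q0 => z h1 hl q0.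
move: (hit _ _ _) (pstep _ _) hl hp => h2 p hl hp hp1' hh.
nra.
Qed.

(** At a first visit to [x] beyond the whole past, [x + 1], [x + 2] and [x + 3] have weight [d].
    Forced steps to [x - 1] first raise [y] above [M]; then the supermartingale starts at 1/2 at
    most. *)
Lemma hit_past_first_visit : exists2 k : R, 0 <= k < 1 &
  forall n x g, all (< x) g -> hit (past (x + 3)) n (x :: g) <= k.
Proof.
have dd := d0.
(* Makes the coefficient of [c / a] equal to 1/4. *)
pose be : R := (17 + 4 * d)^-1.
have be0 : 0 < be by rewrite invr_gt0; lra.
have be1 : be < 1 by rewrite invf_lt1; lra.
have hbe : be * (4 + d) / (1 - be) = 1 / 4.
  by rewrite /be; field; apply/andP; split; lra.
(* For [y >= M] the urn term [urn d y / be ^+ 2] is at most 1/4. *)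
pose M : R := 1 + 4 * (d * (d + 1)) / be ^+ 2.
have Mbig : 0 <= 4 * (d * (d + 1)) / be ^+ 2.
  by apply: divr_ge0; [nra|exact: exprn_ge0 (ltW be0)].
pose j := Num.bound M.
have hj : M <= d + j%:R.
  have := archi_boundP (_ : 0 <= M); rewrite -/j => h.
  have : M < j%:R by apply: h; rewrite /M; lra.
  lra.
have p2 : 0 < 2 ^+ j.+1 :> R by apply: exprn_gt0.
have p21 : 1 <= 2 ^+ j.+1 :> R by rewrite exprn_ege1 //; lra.
exists (1 - (1 - 1 / 2) / 2 ^+ j).
  have -> : (1 - 1 / 2) / 2 ^+ j = (2 ^+ j.+1)^-1 :> R.
    by rewrite exprS invfM; congr (_ * _); lra.
  have : 0 < (2 ^+ j.+1)^-1 :> R by rewrite invr_gt0.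
  have : (2 ^+ j.+1)^-1 <= 1 :> R by rewrite invf_le1.
  lra.
move=> n x g hg; apply: (@hit_past_forced M _ x _ _ n j _ d) => //.
- move=> {hj hg}n {}g y hx hM hy hw hI.
  have y0 : 0 < y by rewrite /M in hM; lra.
  apply: le_trans (_ : hit (escape (be / (1 - be)) x) n g <= _).
    apply: sub_hit => // h; rewrite /past /escape => ->//.
  have w1 : weight g (x + 1) = d by apply: hw; rewrite !inE eqxx.
  have w2 : weight g (x + 2) = d by apply: hw; rewrite !inE eqxx orbT.
  have w3 : weight g (x + 3) = d by apply: hw; rewrite !inE eqxx !orbT.
  apply: le_trans (@hit_escape _ _ hD be d x be0 be1 _ n g y hx y0 hy _ _) _.
  + exact: ltW.
  + by rewrite w3.
  + by rewrite w1 w2 -addrA addrC lerD2r.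
  rewrite w1 w2 hbe divff ?mulr1; last lra.
  have : urn d y / be ^+ 2 <= 1 / 4.
    rewrite /urn ler_pdivrMr ?exprn_gt0 // ler_pdivrMr; last nra.
    have : 4 * (d * (d + 1)) <= be ^+ 2 * y.
      rewrite (mulrC _ y) -ler_pdivrMr ?exprn_gt0 //.
      by apply: le_trans hM; rewrite /M lerDr ler01.
    have : y <= (d + y) * (d + y + 1) by nra.
    have : 0 < be ^+ 2 by rewrite exprn_gt0.
    move: (be ^+ 2) ((d + y) * _) (d * _) => b2 s1 s2 h1 h2 h3; nra.
  lra.
- have : d + 0 <= weight (x :: g) (x - 1) by rewrite addr0; exact: weight_ge.
  by rewrite addr0.
- move=> v; rewrite !inE => hv; apply: weight_unvisited.
  rewrite inE negb_or; apply/andP; split; first by ilia.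
  by apply/negP => /(allP hg) /= h; ilia.
- rewrite /= eqxx weight_cons eqxx weight_unvisited //.
  by apply/negP => /(allP hg) /=; rewrite ltxx.
Qed.

(** New maxima at [v0], [v0 + 3], and so on are first visits, and each further advance by 3 costs a
    factor [k]. *)
Lemma hit_past_geometric : exists2 k : R, 0 <= k < 1 &
  forall j n v0, hit (past (v0 + 3 * j%:Z)) n [:: v0] <= k ^+ j.
Proof.
have [k k01 hk] := hit_past_first_visit; exists k => //.
have /andP[k0 k1] := k01.
suff H j m n g : head 0 g <= m -> all (< m) (behead g) -> g != [::] ->
    hit (past (m + 3 * j%:Z)) n g <= k ^+ j.
  by move=> j n v0; exact: H.
elim: j m n g => [|j IH] m n g hm hg g0; first by rewrite expr0 hit_le1.
(* No site from [m'] on was visited before the present, and the walk is not beyond [m']: a path in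
   [S m'] that reaches [m'] does so for the first time. *)
pose S m' g := [&& head 0 g <= m', all (< m') (behead g) & g != [::]].
have SN m' m'' h : m' <= m'' -> S m' h -> ~~ past m' h ->
    [&& ~~ past m'' h, S m' (step 1 h) & S m' (step (-1) h)].
  case: h => [|z h]; rewrite /S /past /step /= ?andbF // -!ltNge !andbT.
  by move=> hm' /andP[h1 ->] h2; rewrite h2 !andbT; ilia.
have Sg : S m g by rewrite /S hm hg.
have ltm i : m <= m + 3 * i%:Z by ilia.
have -> : m + 3 * (j.+1)%:Z = m + 3 + 3 * j%:Z by ilia.
have step1 h : S (m + 3) h -> forall n', hit (past (m + 3 + 3 * j%:Z)) n' h <=
    k ^+ j * hit (past (m + 3)) n' h.
  move=> Sh n'; apply: (@hit_mul _ _ hD (S (m + 3))) => //.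
  - by move=> h' /and3P[h1 h2 h3] _ n''; exact: IH.
  - by move=> h'; apply: SN; ilia.
have step2 h n' : S m h -> past m h -> hit (past (m + 3)) n' h <= k.
  case: h => [|z h]; rewrite /S /past /= ?andbF // => /and3P[h1 h2 _] h3.
  by have -> : z = m; [apply/eqP; rewrite eq_le h1|exact: hk].
have : hit (past (m + 3 + 3 * j%:Z)) n g <= k ^+ j.+1 * hit (past m) n g.
  apply: (@hit_mul _ _ hD (S m)) => //.
  - move=> h Sh ph n'; apply: le_trans (step1 _ _ n') _.
      case: h Sh {ph} => [|z h]; rewrite /S /= ?andbF // => /and3P[h1 h2 _].
      apply/and3P; split=> //; first by ilia.
      by apply: sub_all h2 => i /=; ilia.
    rewrite exprSr; apply: ler_wpM2l; first exact: exprn_ge0.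
    exact: step2.
  - by move=> h; apply: SN; ilia.
move=> /le_trans; apply; rewrite -[leRHS]mulr1.
by apply: ler_wpM2l; [exact: exprn_ge0|exact: hit_le1].
Qed.

(** With [be = 9/10] and both neighbours of weight close to [N], the urn term is close to
    [(1/4) / (81/100)], below 9/20, and the term in [c / a] is small for large [N]. *)
Lemma hit_escape_balanced (D : nat) : exists N0 : nat, forall N n x g,
  (N0 <= N)%N -> head 0 g = x ->
  (N <= count_mem (x - 1)%R g)%N ->
  (N <= count_mem (x + 1)%R g <= N + D)%N ->
  (N.*2 <= count_mem x g)%N -> (count_mem (x + 2)%R g <= D)%N ->
  (count_mem (x + 3)%R g <= D)%N ->
  hit (escape 9 x) n g <= 9 / 20.
Proof.
have dd := d0.
pose E : R := D%:R + d.
have D0 : 0 <= D%:R :> R by rewrite ler0n.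
(* The first summand keeps [a / (a + y)] below 53/100, the second keeps the term in [c / a] below
   1/10. *)
pose M : R := 20 * (E + 1) + 90 * ((4 + E) * E).
have M0 : 0 <= M by rewrite /M /E; nra.
exists (Num.bound M) => N n x g hN hx hl /andP[hr hr'] hc h2 h3.
have hNM : M < N%:R.
  by apply: lt_le_trans (archi_boundP M0) _; rewrite ler_nat.
have wle v i : (count_mem v g <= i)%N -> weight g v <= i%:R + d.
  by move=> h; rewrite /weight /d natrD -addrA addrC -addrA lerD // ?ler_nat //;
    rewrite addrC.
have wge v i : (i <= count_mem v g)%N -> i%:R + d <= weight g v.
  move=> h; rewrite /weight /d natrD -[leRHS]addrA [leRHS]addrCA.
  by rewrite lerD // ler_nat.
have a1 := wge _ _ hr; have := wle _ _ hr'; rewrite natrD => a2.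
have Y1 := wge _ _ hl; have c2 := wle _ _ h2; have t2 := wle _ _ h3.
have := wge _ _ hc; rewrite -mul2n natrM => b1.
have c1 : d <= weight g (x + 2) by exact: weight_ge.
have be : 9 / 10 / (1 - 9 / 10) = 9 :> R by field.
(* Since [a <= N + E], this gives [a + y + 1 <= 2 * N], as the visit count at [x] requires. *)
pose y : R := N%:R - E - 1.
have E0 : 0 < E by rewrite /E; lra.
have EE : 0 <= (4 + E) * E by nra.
have N20 : 20 * (E + 1) + 90 * ((4 + E) * E) < N%:R by [].
have dE : d <= E by rewrite /E; lra.
rewrite -be.
apply: le_trans (@hit_escape _ _ hD (9 / 10) E x _ _ _ n g y _ _ _ _ _) _;
  rewrite ?hx ?eqxx //; try (rewrite /y; lra).
  by rewrite -[true%:R]/(1 : R) /y /E; lra.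
move: (weight g (x + 1)) (weight g (x + 2)) a1 a2 c1 c2 => a c a1 a2 c1 c2.
have aN : N%:R <= a by lra.
have a0 : 0 < a by lra.
have -> : 9 / 10 * (4 + E) / (1 - 9 / 10) = 9 * (4 + E) by field.
have K1 : 9 * (4 + E) * (c / a) <= 1 / 10.
  rewrite mulrA ler_pdivrMr // mulrC.
  have : c * (4 + E) <= E * (4 + E) by apply: ler_wpM2r; rewrite /E; lra.
  lra.
have U1 : urn a y <= 281 / 1000.
  rewrite /urn ler_pdivrMr; last by rewrite /y; nra.
  have u1 : a <= 53 / 100 * (a + y) by rewrite /y /E; rewrite /E in N20 EE; lra.
  have u2 : a + 1 <= 53 / 100 * (a + y + 1).
    by rewrite /y /E; rewrite /E in N20 EE; lra.
  have : a * (a + 1) <= (53 / 100 * (a + y)) * (53 / 100 * (a + y + 1)).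
    by apply: ler_pM; lra.
  have : 0 <= (a + y) * (a + y + 1) by rewrite /y; nra.
  by move: (a + y) (a + y + 1) => s s'; lra.
have : urn a y / (9 / 10) ^+ 2 <= 281 / 810 by rewrite ler_pdivrMr; lra.
lra.
Qed.

(* The predicate [Q] holds at every time [>= m] of the path. *)
Fixpoint survives (Q : pred (seq int)) (m : nat) g : bool :=
  if g is _ :: g' then (size g' < m)%N || (Q g && survives Q m g') else true.

(** The scenario to be excluded: [x + 2] is avoided although each visit to [x + 1] offers it a
    chance of at least [d / (C * weight g (x + 1))]. *)
Definition quiet (C : R) x : pred (seq int) := fun g =>
  (head 0 g != x + 2) &&
  ((head 0 g == x + 1) ==>
    (weight g x + weight g (x + 2) <= C * weight g (x + 1))).

(** The chances missed at [x + 1] are of order [1 / a] and sum like the harmonic series, so staying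
    quiet until [a] reaches [L] becomes unlikely as [L] grows. *)
Lemma hit_survives (C : R) x m g (eps : R) : 0 < C -> 0 < eps ->
  size g = m.+1 -> exists L : nat, forall n,
   hit (fun h => survives (quiet C x) m h && (L%:R <= weight h (x + 1))) n g
   <= eps.
Proof.
move=> C0 eps0 sg; have dd := d0.
pose a h := weight h (x + 1).
have a0 h : 0 < a h by exact: weight_gt0.
(* While the walk is quiet, each visit to [x + 1] leads to [x + 2] with
   probability at least [k / a]; the unbounded [G] compensates these losses. *)
pose k : R := d / C.
have k0 : 0 < k by exact: divr_gt0.
pose G (w : R) : R := 1 + k * ln (1 + w).
have G1 w : 0 <= w -> 1 <= G w.
  by move=> w0; rewrite lerDl mulr_ge0 ?(ltW k0) // ln_ge0; lra.
have Gmono w z : 0 <= w -> w <= z -> G w <= G z.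
  move=> w0 wz; rewrite lerD2l; apply: ler_wpM2l; first exact: ltW.
  by rewrite ler_ln ?posrE; lra.
have Gstep w : 1 < w -> G w * (1 - k / w) <= G (w - 1).
  move=> w1; have kw : 0 <= k / w by rewrite divr_ge0 ?ltW //; lra.
  have : G w <= G (w - 1) + k / w.
    rewrite /G -addrA lerD2l -mulrDr ler_pM2l //.
    have -> : 1 + (w - 1) = w by lra.
    have -> : 1 + w = w * (1 + w^-1) by rewrite mulrDr mulr1 divff; lra.
    have wi : 0 < w^-1 by rewrite invr_gt0; lra.
    by rewrite lnM ?posrE ?lerD2l ?le_ln1Dx //; lra.
  have := G1 w; nra.
pose z (L : nat) := G (L%:R).
(* At [x + 1] the chance belonging to the present visit is still to come, hence [a h - 1]. *)
pose val L h := (if head 0 h == x + 1 then G (a h - 1) else G (a h)) / z L.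
have [L hL] : exists L : nat, G (a g) / eps <= z L.
  pose M := G (a g) / (eps * k).
  have Ga : 0 < G (a g) by apply: lt_le_trans ltr01 (G1 _ (ltW (a0 g))).
  have M0 : 0 <= M by apply: divr_ge0; [exact: ltW|exact: ltW (mulr_gt0 _ _)].
  exists (Num.bound (expR M)); rewrite /z /G.
  have h : M <= ln (1 + (Num.bound (expR M))%:R).
    rewrite -[leLHS]expRK ler_ln ?posrE ?expR_gt0 //.
      by have := archi_boundP (expR_ge0 M); lra.
  have : k * M <= k * ln (1 + (Num.bound (expR M))%:R) by rewrite ler_pM2l.
  have -> : k * M = G (a g) / eps.
    by rewrite /M; field; apply/andP; split; lra.
  by move=> /le_trans; apply; rewrite lerDr ler01.
have z0 : 0 < z L by apply: lt_le_trans (G1 _ _); rewrite ?ltr01 ?ler0n.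
(* One more than [L], so that [a h - 1] also reaches [L] when the walk stands at [x + 1]. *)
exists L.+1 => n.
pose V h u := [/\ 0 <= u, (m < size h)%N & survives (quiet C x) m h ->
  (head 0 h = x + 1 -> 1 < a h) /\ val L h <= u].
apply: (@hit_le_potential _ _ hD V) => //.
- by move=> h u [].
- move=> h u [u0 sh hu].
  have [sv|nsv] := boolP (survives (quiet C x) m h); last first.
    right; split=> //.
    have V0 e : V (step e h) 0.
      split=> //; first exact: leq_trans sh (leqnSn _).
      by rewrite /= ltnNge (ltnW sh) /= (negbTE nsv) andbF.
    by exists 0, 0; split; rewrite ?mulr0 ?addr0.
  have [h1 hv] := hu sv.
  have [Lh|Lh] := leP L.+1%:R (a h).
    left; apply: le_trans hv; rewrite /val ler_pdivlMr // mul1r.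
    have L0 := ler0n R L; move: Lh; rewrite -natr1 => Lh.
    by case: ifP => _; apply: Gmono => //; lra.
  right; split=> //.
  have Vsize e : (m < size (step e h))%N by exact: leq_trans sh (leqnSn _).
  have Qh : quiet C x h.
    case: h sh sv {hu h1 hv Lh Vsize} => //= i h.
    by rewrite ltnS leqNgt => /negbTE-> /andP[].
  have [hx|hx] := eqVneq (head 0 h) (x + 1); last first.
    rewrite /val (negbTE hx) in hv.
    have Vu e : V (step e h) u.
      split=> // _; rewrite /val head_step; have [E|E] := eqVneq.
        have -> : a (step e h) = a h + 1 by rewrite /a -E weight_step_eq.
        by rewrite addrK; split=> // _; rewrite ltrDr.
      by rewrite /a weight_step_neq //; split=> // E'; rewrite E' eqxx in E.
    exists u, u; split=> //; rewrite pstepE //; lra.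
  have ah := h1 hx; rewrite /val hx eqxx in hv.
  (* A step to [x + 2] ends survival, so it has value 0. *)
  exists 0, (G (a h) / z L); split.
  - split=> //; rewrite /= /quiet head_step hx.
    by rewrite (_ : x + 1 + 1 == x + 2) ?ltnNge ?(ltnW sh) //; ilia.
  - split=> //.
      by rewrite divr_ge0 ?(ltW z0) // (le_trans ler01 (G1 _ (ltW (a0 h)))).
    rewrite /val head_step hx => _.
    rewrite (_ : x + 1 + -1 == x + 1 = false); last ilia.
    by rewrite /a weight_step_neq ?hx; [split=> // E; exfalso; ilia|ilia].
  rewrite mulr0 add0r mulrA; apply: le_trans hv; rewrite ler_pM2r ?invr_gt0 //.
  apply: le_trans (Gstep _ ah); rewrite mulrC; apply: ler_wpM2l.
    exact: le_trans ler01 (G1 _ (ltW (a0 h))).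
  rewrite pstepE // lerD2l lerN2 /pstep hx.
  move: Qh => /andP[_]; rewrite hx eqxx /= => Qh.
  have -> : x + 1 + 1 = x + 2 by ilia.
  have -> : x + 1 - 1 = x by ilia.
  have w2 : d <= weight h (x + 2) by exact: weight_ge.
  have w0 := weight_gt0 hD h x.
  rewrite ler_pdivlMr; last by lra.
  apply: le_trans w2; rewrite mulrAC ler_pdivrMr // /k mulrAC ler_pdivrMr //.
  rewrite -mulrA ler_pM2l //.
  by rewrite [leRHS]mulrC.
have a1 : head 0 g = x + 1 -> 1 < a g.
  case: g sg {hL} => //= i g' _ ->.
  by rewrite /a weight_cons eqxx ltrDr weight_gt0.
split; [exact: ltW|by rewrite sg|move=> _; split=> //].
have Gg : G (a g) / z L <= eps by rewrite ler_pdivrMr // mulrC -ler_pdivrMr.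
rewrite /val; case: ifP => // /eqP /a1 ag; apply: le_trans Gg.
rewrite ler_pM2r ?invr_gt0 //; apply: Gmono;
  by rewrite ?gerBl ?ler01 ?subr_ge0 ?ltW.
Qed.
End Estimates.

(** * Transfer to the probability space *)

Fixpoint trace (T : Type) (X : nat -> T -> int) (n : nat) (w : T) : seq int :=
  if n is n'.+1 then X n w :: trace X n' w else [:: X 0%N w].

Section Trace.
Local Open Scope classical_set_scope.
Variables (T : Type) (X : nat -> T -> int).

Lemma size_trace n w : size (trace X n w) = n.+1.
Proof. by elim: n => //= n ->. Qed.

Lemma head_trace n w : head 0 (trace X n w) = X n w.
Proof. by case: n. Qed.

Lemma visits_trace n v w : visits X n v w = (1 + count_mem v (trace X n w))%N.
Proof.
rewrite /visits; congr (1 + _)%N; elim: n => [|n IH].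
  by rewrite big_ord1 /= addn0.
by rewrite big_ord_recr /= IH addnC.
Qed.

Lemma count_trace_mono v w m n : (m <= n)%N ->
  (count_mem v (trace X m w) <= count_mem v (trace X n w))%N.
Proof.
elim: n => [|n IH]; first by rewrite leqn0 => /eqP->.
rewrite leq_eqVlt => /orP[/eqP->//|/IH le].
exact: leq_trans le (leq_addl _ _).
Qed.

Definition recurrent (w : T) (v : int) :=
  forall L, exists n, (L <= count_mem v (trace X n w))%N.

Lemma recurrentP v w :
  (forall m, exists2 n, (m <= n)%N & X n w = v) -> recurrent w v.
Proof.
move=> H; elim=> [|L [m Lm]]; first by exists 0%N.
have [[|n] mn Xn] := H m.+1; first by [].
exists n.+1; rewrite /= Xn eqxx add1n ltnS.
by apply: leq_trans Lm _; apply: count_trace_mono.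
Qed.

Lemma count_trace_bounded v w m : (forall n, (m < n)%N -> X n w != v) ->
  forall n, (count_mem v (trace X n w) <= count_mem v (trace X m w))%N.
Proof.
move=> H; elim=> [|n IH]; first exact: count_trace_mono.
have [le|lt] := leqP n.+1 m; first exact: count_trace_mono.
by rewrite /= (negbTE (H _ lt)).
Qed.

Lemma asymptotic_rangeE (R : realType) w v :
  asymptotic_range R X w v <-> recurrent w v.
Proof.
have ps n : (\sum_(0 <= k < n.+1) ((X k w == v)%:R : R)%:E)%E =
    ((count_mem v (trace X n w))%:R)%:E.
  elim: n => [|n IH]; first by rewrite big_nat1 /= addn0.
  by rewrite big_nat_recr //= IH -EFinD -natrD addnC.
have ge0 k : (0 <= ((X k w == v)%:R : R)%:E)%E by rewrite lee_fin ler0n.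
rewrite /asymptotic_range /= /total_visits; split=> [|H].
  move=> Hinf L; apply: contrapT => /forallNP HL.
  have : (\sum_(0 <= k <oo) ((X k w == v)%:R : R)%:E <= (L%:R : R)%:E)%E.
    apply: lime_le; first exact: is_cvg_nneseries.
    apply: nearW => -[|n]; first by rewrite big_geq // lee_fin ler0n.
    by rewrite ps lee_fin ler_nat ltnW // ltnNge; apply/negP/HL.
  by move: Hinf; case: (limn _) => // r /=.
rewrite (_ : (\sum_(0 <= k <oo) _)%E = +oo%E) //; apply/eqyP => A A0.
have [n hn] := H (Num.bound A).
apply: le_trans (nneseries_lim_ge n.+1 _) => [|k _ _]; last exact: ge0.
rewrite ps lee_fin; apply: le_trans (ltW (archi_boundP (ltW A0))) _.
by rewrite ler_nat.
Qed.
End Trace.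

(** * Probabilities of path cylinders *)

Section Bridge.
Local Open Scope classical_set_scope.
Variables (R : realType) (d : measure_display) (T : measurableType d)
  (P : probability T R) (Delta : R) (v0 : int) (X : nat -> {RV P >-> int}).
Hypothesis hD : -1 < Delta.
Hypothesis hX : vrrw Delta v0 X.

Local Notation pstep := (pstep Delta).
Local Notation hit := (hit Delta).

Definition cyl n (g : seq int) := [set w | trace X n w = g].

Lemma cylS n z g :
  cyl n.+1 (z :: g) = cyl n g `&` [set w | X n.+1 w = z].
Proof. by apply/seteqP; split=> w; [case=> <- <-|case=> /= <- <-]. Qed.

Lemma cyl_filtration m n g : (m <= n)%N -> natural_filtration X n (cyl m g).
Proof.
move=> mn.
have set0F : natural_filtration X n set0.
  exact: (@measurable0 _ (g_sigma_algebraType _)).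
have gen k (kn : (k <= n)%N) z :
    natural_filtration X n [set w | X k w = z].
  apply: sub_sigma_algebra; rewrite -bigcup_seq /=.
  exists (Ordinal (kn : (k < n.+1)%N)); first exact: mem_index_enum.
  by exists [set z] => //; rewrite setTI.
elim: m g mn => [|m IH] [|z g] mn.
- rewrite (_ : cyl _ _ = set0) //.
  by apply/seteqP; split.
- case: g => [|z' g].
    rewrite (_ : cyl _ _ = [set w | X 0%N w = z]); first exact: gen.
    by apply/seteqP; split=> w; [case|move=> /= <-].
  rewrite (_ : cyl _ _ = set0) //.
  by apply/seteqP; split.
- rewrite (_ : cyl _ _ = set0) //.
  by apply/seteqP; split.
rewrite cylS; apply: (@measurableI _ (g_sigma_algebraType _)).
  exact: IH (ltnW mn).
exact: gen.
Qed.

Lemma measurable_X n z : measurable [set w | X n w = z].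
Proof. exact: (measurable_funPTI (X n) (Y := [set z])). Qed.

Lemma measurable_cyl n g : measurable (cyl n g).
Proof.
have : natural_filtration X n (cyl n g) by exact: cyl_filtration.
apply: smallest_sub; first exact: sigma_algebra_measurable.
rewrite -bigcup_seq => A [k _ [B _ <-]].
by apply: (measurable_funP (X k)).
Qed.

(** There are only countably many finite paths, so any set of them gives an event. *)
Lemma measurable_trace n (Q : set (seq int)) :
  measurable [set w | Q (trace X n w)].
Proof.
rewrite (_ : [set w | _] = \bigcup_g (if `[< Q g >] then cyl n g else set0)).
  apply: countable_bigcupT_measurable => [|g]; first exact: countableP.
  by case: ifP => // _; exact: measurable_cyl.
apply/seteqP; split=> w /=.
  by move=> Qw; exists (trace X n w) => //; rewrite asboolT.
by move=> [g _]; case: asboolP => // Qg; rewrite /cyl /= => ->.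
Qed.

(** The cylinder lies in the filtration and the version [Y] is almost everywhere the constant
    [pstep e g] on it, so the defining integral is a product. *)
Lemma prob_cyl_step n g e : e = 1 \/ e = -1 ->
  P (cyl n.+1 (step e g)) = ((pstep e g)%:E * P (cyl n g))%E.
Proof.
move=> he; rewrite cylS; set j := head 0 g + e.
have hj : j = head 0 g - 1 \/ j = head 0 g + 1.
  by rewrite /j; case: he => ->; [right|left].
have [Y [[_ iY hY] aeY]] := hX.2 n (head 0 g) j hj.
have mg := measurable_cyl n g.
rewrite -hY; last exact: cyl_filtration.
rewrite -integral_cst //; apply: ae_eq_integral => //.
  exact: measurable_funS (measurable_int _ iY).
apply: filterS aeY => w hw /= gw.
have Xg : X n w = head 0 g by rewrite -gw head_trace.
rewrite /= hw // !visits_trace gw /pstep /weight -/j.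
by congr ((_ / _)%:E); rewrite mulr_natl mulr2n addrACA.
Qed.

(** The two prescribed probabilities add up to 1, so any other continuation is null. *)
Lemma prob_cyl_other n g :
  P (cyl n g `\` (cyl n.+1 (step 1 g) `|` cyl n.+1 (step (-1) g))) = 0%E.
Proof.
have mg := measurable_cyl n g.
have m1 := measurable_cyl n.+1 (step 1 g).
have m2 := measurable_cyl n.+1 (step (-1) g).
have sub e : cyl n.+1 (step e g) `<=` cyl n g by rewrite cylS; exact: subIsetl.
have m12 := measurableU _ _ m1 m2.
have eD : (P (cyl n g `\` (cyl n.+1 (step 1 g) `|` cyl n.+1 (step (-1) g))) =
    P (cyl n g) - P (cyl n.+1 (step 1 g) `|` cyl n.+1 (step (-1) g)))%E.
  rewrite measureD //; last by rewrite -ge0_fin_numE //; exact: fin_num_measure.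
  by rewrite (setIidr _) //; rewrite subUset; split; exact: sub.
have eU : (P (cyl n.+1 (step 1 g) `|` cyl n.+1 (step (-1) g)) =
    P (cyl n.+1 (step 1 g)) + P (cyl n.+1 (step (-1) g)))%E.
  apply: measureU => //; apply/seteqP; split=> w //= -[]; rewrite /cyl /= => -> [].
  lia.
rewrite eD eU !prob_cyl_step; [|by right|by left].
rewrite -ge0_muleDl ?lee_fin ?ltW ?(pstep_gt0 hD) // -EFinD pstepE //.
by rewrite [(pstep 1 g + _)%R]addrC subrK mul1e subee // fin_num_measure.
Qed.

Definition met (B : pred (seq int)) n K :=
  [set w | exists2 k, (k <= K)%N & B (trace X (n + k) w)].

Lemma measurable_met B n K : measurable (met B n K).
Proof.
rewrite (_ : met _ _ _ = \bigcup_(k < K.+1) [set w | B (trace X (n + k) w)]).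
  by apply: bigcup_measurable => k _; exact: (measurable_trace _ (fun g => B g)).
by apply/seteqP; split=> w [k h1 h2]; exists k.
Qed.

(** Induction along the recursion of [hit], splitting the cylinder by the next step. *)
Lemma prob_met B K n g :
  (P (cyl n g `&` met B n K) <= (hit B K g)%:E * P (cyl n g))%E.
Proof.
have mg n' g' := measurable_cyl n' g'.
have mm n' K' := measurable_met B n' K'.
have trivial_bound n' g' K' : (P (cyl n' g' `&` met B n' K') <= P (cyl n' g'))%E.
  by apply: le_measure; rewrite ?inE //; exact: measurableI.
elim: K n g => [|K IH] n g.
  rewrite /=; case: ifP => Bg; first by rewrite mul1e.
  rewrite mul0e (_ : _ `&` _ = set0) ?measure0 //.
  apply/seteqP; split=> w // [gw [[|k] //]].
  by rewrite addn0 gw Bg.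
rewrite /=; case: ifP => Bg; first by rewrite mul1e.
pose other := cyl n g `\` (cyl n.+1 (step 1 g) `|` cyl n.+1 (step (-1) g)).
have mo : measurable other by apply: measurableD => //; exact: measurableU.
have sub : cyl n g `&` met B n K.+1 `<=`
    (cyl n.+1 (step 1 g) `&` met B n.+1 K)
    `|` (cyl n.+1 (step (-1) g) `&` met B n.+1 K) `|` other.
  move=> w [gw [[|k] hk Bk]].
    by move: Bk; rewrite addn0 gw Bg.
  have mw : met B n.+1 K w by exists k => //; rewrite addSnnS.
  have [w1|w1] := pselect (cyl n.+1 (step 1 g) w); first by left; left.
  have [w2|w2] := pselect (cyl n.+1 (step (-1) g) w); first by left; right.
  by right; split=> // -[].
have uni A C : measurable A -> measurable C -> (P (A `|` C) <= P A + P C)%E.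
  exact: measureU2.
have m1 : measurable (cyl n.+1 (step 1 g) `&` met B n.+1 K).
  exact: measurableI.
have m2 : measurable (cyl n.+1 (step (-1) g) `&` met B n.+1 K).
  exact: measurableI.
have m12 := measurableU _ _ m1 m2.
have le1 := le_measure P (mem_set (measurableI _ _ (mg n g) (mm n K.+1)))
  (mem_set (measurableU _ _ m12 mo)) sub.
apply: le_trans le1 _; apply: le_trans (uni _ _ m12 mo) _.
rewrite prob_cyl_other adde0; apply: le_trans (uni _ _ m1 m2) _.
rewrite EFinD muleDl ?fin_num_measure //.
by apply: leeD; rewrite mulrC EFinM -muleA -prob_cyl_step ?IH //; [left|right].
Qed.

Lemma prob_met_ever B n g (b : R) : (forall K, hit B K g <= b) ->
  (P (cyl n g `&` [set w | exists k, B (trace X (n + k) w)])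
    <= b%:E * P (cyl n g))%E.
Proof.
move=> hb.
have mF K : measurable (cyl n g `&` met B n K).
  by apply: measurableI; [exact: measurable_cyl|exact: measurable_met].
rewrite (_ : _ `&` _ = \bigcup_K (cyl n g `&` met B n K)); last first.
  apply/seteqP; split=> w.
    by move=> [gw [k Bk]]; exists k => //; split=> //; exists k.
  by move=> [K _ [gw [k _ Bk]]]; split=> //; exists k.
apply: cvge_le (nondecreasing_cvg_mu mF _ _).
- apply: nearW => K; apply: le_trans (prob_met _ _ _ _) _.
  by apply: lee_wpmul2r => //; rewrite lee_fin.
- exact: bigcupT_measurable.
- apply/nondecreasing_seqP => K; apply/subsetPset; apply: setIS => w [k hk Bk].
  by exists k => //; exact: leqW.
Qed.

Lemma prob_start : P (cyl 0 [:: v0]) = 1%E.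
Proof.
rewrite (_ : cyl _ _ = [set w | X 0%N w = v0]); last first.
  by apply/seteqP; split=> w; [case|move=> /= <-].
have mA := measurable_X 0 v0.
have : P (~` [set w | X 0%N w = v0]) = 0%E.
  by apply/negligibleP; [exact: measurableC|exact: hX.1].
rewrite probability_setC // => /eqP.
by rewrite sube_eq ?fin_num_measure // ?add0e => /eqP <-.
Qed.

Lemma negligible_bigcup_countable (I : countType) (A : I -> set T) :
  (forall i, P.-negligible (A i)) -> P.-negligible (\bigcup_i A i).
Proof.
move=> hA; apply: (@negligibleS _ _ _ P
    (\bigcup_n (if @unpickle I n is Some i then A i else set0))).
  by move=> w [i _ Aw]; exists (pickle i) => //; rewrite pickleK.
apply: negligible_bigcup => n.
by case: unpickle => [i|]; [exact: hA|exact: negligible_set0].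
Qed.

Lemma ae_nearest_neighbour :
  {ae P, forall w n, X n.+1 w = X n w + 1 \/ X n.+1 w = X n w - 1}.
Proof.
pose other n g := cyl n g `\` (cyl n.+1 (step 1 g) `|` cyl n.+1 (step (-1) g)).
apply: (@negligibleS _ _ _ P (\bigcup_n \bigcup_g other n g)).
  move=> w /= /existsNP[n Hn]; exists n => //; exists (trace X n w) => //.
  split=> // Hc; apply: Hn.
  by case: Hc; rewrite /cyl /= /step head_trace => -[->]; [left|right].
apply: negligible_bigcup => n; apply: negligible_bigcup_countable => g.
apply/negligibleP; last exact: prob_cyl_other.
by apply: measurableD; [|apply: measurableU]; exact: measurable_cyl.
Qed.
End Bridge.

Lemma trace_map (T : Type) (X : nat -> T -> int) (s : int -> int) n w :
  trace (fun k w => s (X k w)) n w = map s (trace X n w).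
Proof. by elim: n => //= n ->. Qed.

Lemma survives_trace (T : Type) (X : nat -> T -> int) (Q : pred (seq int)) m w :
  (forall k, Q (trace X (m + k) w)) ->
  forall k, survives Q m (trace X (m + k) w).
Proof.
move=> HQ; elim=> [|k IH].
  have := HQ 0%N; have := size_trace X m w; rewrite addn0.
  case: (trace X m w) => //= z g [sg] ->; rewrite sg ltnn /=.
  by case: g sg => //= z' g <-; rewrite leqnn.
by have := HQ k.+1; rewrite addnS /= => ->; rewrite IH orbT.
Qed.

(** * Walks confined to five sites *)

Section Confined.
Variables (R : realType) (Delta : R) (T : Type) (X : nat -> T -> int) (w : T).
Variables (x : int) (n0 : nat).
Hypothesis hD : -1 < Delta.
Hypothesis nn : forall n, X n.+1 w = X n w + 1 \/ X n.+1 w = X n w - 1.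
Hypothesis confined : forall n, (n0 <= n)%N -> x - 2 <= X n w <= x + 2.
Hypothesis ratio : forall n, (n0 <= n)%N ->
  weight Delta (trace X n w) (x + 1)
    <= 9 * weight Delta (trace X n w) (x - 1) /\
  weight Delta (trace X n w) (x - 1)
    <= 9 * weight Delta (trace X n w) (x + 1).

Local Ltac ilia :=
  repeat match goal with H : context [R] |- _ => clear H end; lia.

Let cnt (v : int) n := count_mem v (trace X n w).
Let cntS v n : cnt v n.+1 = ((X n.+1 w == v) + cnt v n)%N.
Proof. by []. Qed.

Let weightE v n : weight Delta (trace X n w) v = (cnt v n)%:R + (1 + Delta).
Proof. by rewrite /weight natrD addrAC addrC. Qed.

(** A confined walk is at [x - 1] or [x + 1] at one of any two consecutive times. *)
Let sides L :
  exists2 n, (n0 <= n)%N & (L <= cnt (x + 1)%R n + cnt (x - 1)%R n)%N.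
Proof.
elim: L => [|L [n hn hL]]; first by exists n0.
have [n' hn' hX] :
    exists2 n', (n < n')%N & (X n' w == x + 1) || (X n' w == x - 1).
  have h1 := confined (leqW hn); have h2 := confined (leqW (leqW hn)).
  have h3 := nn n.+1.
  have [e|e] := boolP ((X n.+1 w == x + 1) || (X n.+1 w == x - 1)).
    by exists n.+1.
  by exists n.+2 => //; ilia.
case: n' hn' hX => // n' hn' hX; exists n'.+1; first by ilia.
have := count_trace_mono X (x + 1) w (hn' : (n <= n')%N).
have := count_trace_mono X (x - 1) w (hn' : (n <= n')%N).
rewrite !cntS /cnt; move: hL; rewrite /cnt.
by case/orP: hX => /eqP->; rewrite eqxx; ilia.
Qed.

Lemma visits_both_sides : recurrent X w (x + 1) /\ recurrent X w (x - 1).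
Proof.
have d0 : 0 < 1 + Delta by have := hD; lra.
pose N := Num.bound (1 + Delta).
have hN : 1 + Delta < N%:R by exact: archi_boundP (ltW d0).
suff H L : exists n, (L <= cnt (x + 1)%R n)%N /\ (L <= cnt (x - 1)%R n)%N.
  by split=> L; have [n [h1 h2]] := H L; exists n.
(* By the ratio 9, each side gets about a tenth of the visits; [N] absorbs the offset
   [1 + Delta]. *)
have [n hn hL] := sides (10 * L + 10 * N); exists n.
have [h1 h2] := ratio hn; rewrite !weightE in h1 h2.
have : (10 * L + 10 * N)%:R <= (cnt (x + 1) n)%:R + (cnt (x - 1) n)%:R :> R.
  by rewrite -natrD ler_nat.
rewrite natrD !natrM -!(ler_nat R).
move: ((cnt (x + 1) n)%:R) ((cnt (x - 1) n)%:R) (N%:R) (L%:R) h1 h2 hN.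
by move=> a b c l h1 h2 h3 h4; split; lra.
Qed.

Let not_recurrent v : ~ recurrent X w v ->
  exists2 m, (n0 <= m)%N & forall n, (m <= n)%N -> X n w != v.
Proof.
move=> nV; have : ~ forall m, exists2 n, (m <= n)%N & X n w = v.
  by move=> h; apply: nV; exact: recurrentP.
move=> /existsNP[m hm]; exists (maxn n0 m); first exact: leq_maxl.
move=> n; rewrite geq_max => /andP[_ mn]; apply/eqP => E.
by apply: hm; exists n.
Qed.

Let recurrent_visited v m : recurrent X w v -> exists2 n, (m < n)%N & X n w = v.
Proof.
move=> V; apply: contrapT => H; have [n hn] := V (cnt v m).+1.
have : (cnt v n <= cnt v m)%N.
  by apply: count_trace_bounded => k mk; apply/eqP => E; apply: H; exists k.
by rewrite leqNgt => /negP; apply.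
Qed.

(** Without further visits to [x] the walk would stay on one side of it, but both sides are
    recurrent. *)
Lemma visits_center : recurrent X w x.
Proof.
apply: contrapT => /not_recurrent[m hm Hx].
have side n : (x < X (m + n)%N w) = (x < X m w).
  elim: n => [|n <-]; first by rewrite addn0.
  have h1 := Hx (m + n)%N (leq_addr _ _).
  have h2 := Hx (m + n.+1)%N (leq_addr _ _).
  by have := nn (m + n); rewrite addnS in h2 *; ilia.
have side' n : (m < n)%N -> (x < X n w) = (x < X m w).
  by move=> mn; rewrite -(side (n - m)%N) subnKC // ltnW.
have [V1 V2] := visits_both_sides.
have [n1 /side' h1 e1] := recurrent_visited m V1.
have [n2 /side' h2 e2] := recurrent_visited m V2.
ilia.
Qed.

(** The walk alternates between [x - 1], [x + 1] and the other three sites; [n0.+1] is the length of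
    the path up to time [n0]. *)
Let parity_balance n : (n0 <= n)%N -> (cnt x n + cnt (x + 2)%R n <=
  n0.+1 + cnt (x + 1)%R n + cnt (x - 1)%R n
  + ((X n w != x + 1)%R && (X n w != x - 1)%R))%N.
Proof.
elim: n => [|n IH] hn.
  have -> : n0 = 0%N by ilia.
  by rewrite /cnt /=; ilia.
have [le|lt] := leqP n0 n; last first.
  have e : n0 = n.+1 by ilia.
  rewrite e -addnA; apply: leq_trans (leq_addr _ _).
  rewrite -(size_trace X n.+1 w) -e /cnt; elim: (trace X n0 w) => //= z g h.
  have [->|zx] := eqVneq z x; last by ilia.
  by rewrite (_ : x == x + 2 = false); ilia.
have := IH le; rewrite !cntS.
have := nn n; have := confined le; have := confined hn.
move: (X n.+1 w) (X n w) => z z'; ilia.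
Qed.

(** After the last visit to [x + 2], the balance and the ratio 9 bound the joint weight of [x] and
    [x + 2] by [n0.+1] plus 10 times that of [x + 1], whenever the walk is there. *)
Lemma quiet_of_not_recurrent : ~ recurrent X w (x + 2) ->
  exists m (C : nat), forall k, quiet Delta C.+1%:R x (trace X (m + k) w).
Proof.
move=> /not_recurrent[m hm Hx]; exists m.
have d0 : 0 < 1 + Delta by have := hD; lra.
(* The constant [n0.+1] is absorbed because weights are at least [1 + Delta]. *)
pose C := Num.bound (n0.+1%:R / (1 + Delta) + 10).
have hC : n0.+1%:R / (1 + Delta) + 10 <= C.+1%:R.
  apply/ltW/(lt_trans (archi_boundP _)); last by rewrite ltr_nat.
  by rewrite addr_ge0 // divr_ge0 // ltW.
exists C => k; have mk := leq_addr k m; have n0k := leq_trans hm mk.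
rewrite /quiet head_trace Hx //=; apply/implyP => /eqP hk.
have := parity_balance n0k; rewrite hk eqxx /= addn0 => h.
have {}h : (cnt x (m + k))%:R + (cnt (x + 2) (m + k))%:R <=
    n0.+1%:R + (cnt (x + 1) (m + k))%:R + (cnt (x - 1) (m + k))%:R :> R.
  by rewrite -!natrD ler_nat.
have [_ h2] := ratio n0k.
apply: (@le_trans _ _
  (n0.+1%:R + 10 * weight Delta (trace X (m + k) w) (x + 1))).
  rewrite !weightE in h2 *.
  move: (cnt x _)%:R (cnt (x + 2) _)%:R (cnt (x + 1) _)%:R
    (cnt (x - 1) _)%:R n0.+1%:R h h2.
  by move=> a b c e f h h2; lra.
have wd : 1 + Delta <= weight Delta (trace X (m + k) w) (x + 1).
  exact: weight_ge.
move: (weight _ _ _) wd => a wd.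
apply: le_trans (_ : (n0.+1%:R / (1 + Delta) + 10) * a <= _); last first.
  by apply: ler_wpM2r => //; lra.
have : n0.+1%:R <= n0.+1%:R / (1 + Delta) * a.
  by rewrite mulrAC ler_pdivlMr //; apply: ler_wpM2l.
by move=> h3; rewrite [leRHS]mulrDl; apply: lerD.
Qed.
End Confined.

(** * Almost sure properties *)

Section AlmostSure.
Local Open Scope classical_set_scope.
Variables (R : realType) (d : measure_display) (T : measurableType d)
  (P : probability T R) (Delta : R) (v0 : int) (X : nat -> {RV P >-> int}).
Hypothesis hD : -1 < Delta.
Hypothesis hX : vrrw Delta v0 X.

Lemma negligible_le (A : set T) :
  (forall e : R, 0 < e ->
    exists B, [/\ measurable B, A `<=` B & (P B <= e%:E)%E]) ->
  P.-negligible A.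
Proof.
move=> H.
have [B hB] : {B : nat -> set T & forall n, [/\ measurable (B n), A `<=` B n &
    (P (B n) <= (n.+1%:R^-1)%:E)%E]}.
  by apply: (@choice _ _ (fun n Bn => [/\ measurable Bn, A `<=` Bn &
    (P Bn <= (n.+1%:R^-1)%:E)%E])) => n; apply: H.
have mB n : measurable (B n) by have [] := hB n.
have mI : measurable (\bigcap_n B n) by exact: bigcapT_measurable.
apply: (@negligibleS _ _ _ P (\bigcap_n B n)).
  by move=> w Aw n _; have [_ + _] := hB n; exact.
apply/negligibleP => //; apply/eqP; rewrite eq_le measure_ge0 andbT.
apply/lee_addgt0Pr => e e0; rewrite add0e.
have [_ _ hn] := hB (Num.bound e^-1).
apply: le_trans (le_trans hn _).
  by apply: le_measure; rewrite ?inE //; exact: bigcap_inf.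
rewrite lee_fin invf_ple ?posrE //; apply/ltW/(lt_trans (archi_boundP _)).
  by rewrite invr_ge0 ltW.
by rewrite ltr_nat.
Qed.

Section Reflection.
(* [s] is the identity or the reflection of the line. *)
Variable s : int -> int.
Hypothesis hs : forall B n g,
  hit Delta (B \o map s) n g = hit Delta B n (map s g).

Let X' n w := s (X n w).

(** An unbounded walk passes [s v0 + 3 * j] for every [j], which has probability at most
    [k ^+ j]. *)
Lemma ae_bounded_above : {ae P, forall w, exists M : int, forall n, X' n w < M}.
Proof.
have [k /andP[k0 k1] hk] := hit_past_geometric hD.
apply: (@negligibleS _ _ _ P (~` cyl X 0 [:: v0] `|`
  (cyl X 0 [:: v0] `&` [set w | forall M : int, exists n, M <= X' n w]))).
  move=> w /= /forallNP hw.
  have [w0|w0] := pselect (cyl X 0 [:: v0] w); last by left.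
  right; split=> // M; have /existsNP[n hn] := hw M.
  by exists n; rewrite leNgt; apply/negP.
apply: negligibleU.
  have h0 : P (~` cyl X 0 [:: v0]) = 0%E.
    rewrite probability_setC; last exact: measurable_cyl.
    by rewrite (prob_start hX) subee.
  by apply/negligibleP => //; apply: measurableC; exact: measurable_cyl.
apply: negligible_le => e e0.
have [j hj] : exists j, k ^+ j <= e.
  have k1' : `|k| < 1 by rewrite ger0_norm.
  have /cvgr0Pnorm_le /(_ e e0) [j _ /(_ j (leqnn j))] := cvg_expr k1'.
  by rewrite /= ger0_norm ?exprn_ge0 //; exists j.
pose B := past (s v0 + 3 * j%:Z) \o map s.
exists (cyl X 0 [:: v0] `&` [set w | exists n, B (trace X (0 + n) w)]); split.
- apply: measurableI; first exact: measurable_cyl.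
  rewrite (_ : [set w | _] = \bigcup_n [set w | B (trace X n w)]).
    by apply: bigcupT_measurable => n; exact: (measurable_trace _ _ (fun g => B g)).
  by apply/seteqP; split=> w [n]; [exists n|exists n].
- move=> w [w0 hw]; split=> //; have [n hn] := hw (s v0 + 3 * j%:Z).
  by exists n; rewrite /B /= -trace_map /past head_trace.
have hB K : hit Delta B K [:: v0] <= k ^+ j by rewrite hs /=.
apply: le_trans (prob_met_ever hD hX 0 hB) _.
by rewrite (prob_start hX) mule1 lee_fin.
Qed.

(** For a fixed time [m], past [g] and constant [C], the event forces survival up to every level
    [L], so it is null; there are countably many such triples. *)
Lemma ae_not_quiet (x : int) : {ae P, forall w, recurrent X' w (x + 1) ->
  ~ exists m (C : nat), forall k, quiet Delta C.+1%:R x (trace X' (m + k) w)}.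
Proof.
pose A m g C := cyl X m g `&` [set w | recurrent X' w (x + 1) /\
  forall k, quiet Delta C.+1%:R x (trace X' (m + k) w)].
apply: (@negligibleS _ _ _ P (\bigcup_m \bigcup_g \bigcup_C A m g C)).
  move=> w /= /not_implyP[hio /contrapT[m [C hC]]].
  by exists m => //; exists (trace X m w) => //; exists C.
apply: negligible_bigcup => m; apply: negligible_bigcup_countable => g.
apply: negligible_bigcup => C; apply: negligible_le => e e0.
have [sg|sg] := eqVneq (size g) m.+1; last first.
  exists set0; split=> //; last by rewrite measure0 lee_fin ltW.
  by move=> w [gw _]; move: sg; rewrite -gw size_trace eqxx.
have sg' : size (map s g) = m.+1 by rewrite size_map.
have C0 : 0 < C.+1%:R :> R by rewrite ltr0n.
have [L hL] := hit_survives hD x C0 e0 sg'.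
pose B : pred (seq int) := (fun h => survives (quiet Delta C.+1%:R x) m h
  && (L%:R <= weight Delta h (x + 1))) \o map s.
have mB : measurable [set w | exists n, B (trace X (m + n) w)].
  rewrite (_ : [set w | _] = \bigcup_n [set w | B (trace X (m + n) w)]).
    by apply: bigcupT_measurable => n; exact: (measurable_trace _ _ (fun g => B g)).
  by apply/seteqP; split=> w [n]; [exists n|exists n].
exists (cyl X m g `&` [set w | exists n, B (trace X (m + n) w)]); split.
- by apply: measurableI => //; exact: measurable_cyl.
- move=> w [gw [hio hq]]; split=> //.
  have [n hn] := hio L; exists n; rewrite /B /= -trace_map survives_trace //=.
  apply: le_trans (_ : (count_mem (x + 1) (trace X' (m + n) w))%:R <= _).
    rewrite ler_nat; apply: leq_trans hn _.
    by apply: count_trace_mono; exact: leq_addl.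
  by rewrite /weight natrD addrAC lerDr; have := hD; lra.
have hB K : hit Delta B K g <= e by rewrite hs.
apply: le_trans (prob_met_ever hD hX m hB) _.
rewrite -[leRHS]mule1; apply: lee_wpmul2l; first by rewrite lee_fin ltW.
by apply: probability_le1; exact: measurable_cyl.
Qed.
End Reflection.

(** * Initial paths of positive probability *)

Lemma prob_extend n g (e : int) : (0 < P (cyl X n g))%E ->
  e = 1 \/ e = -1 -> (0 < P (cyl X n.+1 (step e g)))%E.
Proof.
move=> Pg he; rewrite (prob_cyl_step hX) //.
by rewrite mule_gt0 // lte_fin; exact: pstep_gt0.
Qed.

Lemma reach (x : int) : exists n g, (0 < P (cyl X n g))%E /\ head 0 g = x.
Proof.
suff H (e : int) (k : nat) : e = 1 \/ e = -1 ->
    exists n g, (0 < P (cyl X n g))%E /\ head 0 g = v0 + e * k%:Z.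
  have [h|h] := leP v0 x.
    have [n [g [h1 h2]]] := H 1 (`|x - v0|)%N (or_introl erefl).
    by exists n, g; split=> //; lia.
  have [n [g [h1 h2]]] := H (-1) (`|x - v0|)%N (or_intror erefl).
  by exists n, g; split=> //; lia.
move=> he; elim: k => [|k [n [g [h1 h2]]]].
  exists 0%N, [:: v0]; split; last by rewrite /= mulr0 addr0.
  by rewrite (prob_start hX) lte01.
exists n.+1, (step e g); split; first exact: prob_extend.
by rewrite /= h2; lia.
Qed.

(** From [x] through [x + 1], [x] and [x - 1] back to [x]: one visit to each neighbour and two to
    [x]. *)
Let loop g := step 1 (step (-1) (step (-1) (step 1 g))).

(** Any path to [x] followed by [N] loops. [D] is chosen before [N]: the imbalance and the visits
    farther out come from the first path alone. *)
Lemma reach_balanced (x : int) : exists D, forall N, exists n g,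
  [/\ (0 < P (cyl X n g))%E, head 0 g = x,
   (N <= count_mem (x - 1)%R g <= N + D)%N,
   (N <= count_mem (x + 1)%R g <= N + D)%N &
   [/\ (N.*2 <= count_mem x g)%N,
   (count_mem (x + 2)%R g <= D)%N, (count_mem (x - 2)%R g <= D)%N,
   (count_mem (x + 3)%R g <= D)%N & (count_mem (x - 3)%R g <= D)%N]].
Proof.
have [n0 [g0 [h0 x0]]] := reach x; exists (size g0) => N.
suff [n [g [Pg hg [c1 c2 c3] [c4 c5 c6 c7]]]] : exists n g,
    [/\ (0 < P (cyl X n g))%E, head 0 g = x,
    [/\ count_mem (x - 1) g = (N + count_mem (x - 1)%R g0)%N,
     count_mem (x + 1) g = (N + count_mem (x + 1)%R g0)%N &
     count_mem x g = (N.*2 + count_mem x g0)%N] &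
    [/\ count_mem (x + 2) g = count_mem (x + 2) g0,
     count_mem (x - 2) g = count_mem (x - 2) g0,
     count_mem (x + 3) g = count_mem (x + 3) g0 &
     count_mem (x - 3) g = count_mem (x - 3) g0]].
  exists n, g; rewrite c1 c2 c3 c4 c5 c6 c7 !leq_addr !leq_add2l !count_size.
  by split.
elim: N => [|N [n [g [rg hg [c1 c2 c3] [c4 c5 c6 c7]]]]]; first by exists n0, g0.
have cl (v : int) : count_mem v (loop g) =
    ((x == v) + ((x - 1)%R == v) + (x == v) + ((x + 1)%R == v)
     + count_mem v g)%N.
  rewrite /loop /= hg (_ : x + 1 + -1 = x); last by lia.
  by rewrite (_ : x + -1 + 1 = x) ?addnA //; lia.
exists n.+4, (loop g); split.
- by do 4 (apply: prob_extend; [|by [left|right]]).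
- by rewrite /loop /= hg; lia.
- by split; rewrite cl ?c1 ?c2 ?c3; clear -x; lia.
- by split; rewrite cl ?c4 ?c5 ?c6 ?c7; clear -x; lia.
Qed.
End AlmostSure.

(** The pathwise part, to be applied outside the null sets: [q1] and [q2] exclude quiet behaviour of
    the walk and of its reflection. *)
Lemma recurrent_confined (R : realType) (Delta : R) (T : Type)
    (X : nat -> T -> int) (w : T) (x : int) (n0 : nat) :
  -1 < Delta ->
  (forall n, X n.+1 w = X n w + 1 \/ X n.+1 w = X n w - 1) ->
  (forall n, (n0 <= n)%N -> x - 2 <= X n w <= x + 2) ->
  (forall n, (n0 <= n)%N ->
    weight Delta (trace X n w) (x + 1)
      <= 9 * weight Delta (trace X n w) (x - 1) /\
    weight Delta (trace X n w) (x - 1)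
      <= 9 * weight Delta (trace X n w) (x + 1)) ->
  (recurrent X w (x + 1) ->
    ~ exists m (C : nat), forall k,
      quiet Delta C.+1%:R x (trace X (m + k) w)) ->
  (recurrent (fun n u => - X n u) w (- x + 1) ->
    ~ exists m (C : nat), forall k,
      quiet Delta C.+1%:R (- x) (trace (fun n u => - X n u) (m + k) w)) ->
  forall v, recurrent X w v <-> x - 2 <= v <= x + 2.
Proof.
move=> hD nn conf ratio q1 q2 v; split=> [V|].
  have [//|nv] := boolP (x - 2 <= v <= x + 2).
  have [n] := V (count_mem v (trace X n0 w)).+1.
  rewrite ltnNge count_trace_bounded // => k n0k.
  by apply/eqP => E; move: nv; rewrite -E conf // ltnW.
have [V1 V2] := visits_both_sides hD nn conf ratio.
have V0 := visits_center hD nn conf ratio.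
have V3 : recurrent X w (x + 2).
  apply: contrapT => /(quiet_of_not_recurrent hD nn conf ratio).
  exact: q1.
have V4 : recurrent X w (x - 2).
  apply: contrapT => V4.
  (* Reflection turns [x - 1] and [x - 2] into [- x + 1] and [- x + 2]. *)
  apply: q2 => [L|].
    have [n hn] := V2 L; exists n; rewrite (trace_map X -%R) count_map_opp.
    by rewrite opprD opprK.
  apply: (quiet_of_not_recurrent hD (n0 := n0)).
  - by move=> n; have := nn n; lia.
  - by move=> n /conf; lia.
  - move=> n /ratio[h1 h2].
    by rewrite (trace_map X -%R) !weight_map_opp !opprD !opprK.
  - move=> V5; apply: V4 => L; have [n hn] := V5 L; exists n.
    by move: hn; rewrite (trace_map X -%R) count_map_opp opprD opprK.
move=> hv.
have : [|| v == x - 2, v == x - 1, v == x, v == x + 1 | v == x + 2].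
  by clear -hv; lia.
by case/or4P => [/eqP->|/eqP->|/eqP->|/orP[/eqP->|/eqP->]].
Qed.

Theorem theorem1 (R : realType) (d : measure_display) (T : measurableType d)
    (P : probability T R) (Delta : R) (hDelta : -1 < Delta) (v0 : int)
    (X : nat -> {RV P >-> int}) (hX : vrrw Delta v0 X) :
  {ae P, forall w, finite_set (asymptotic_range R X w)} /\
  forall x : int,
    (0%:E < P [set w | asymptotic_range R X w =
                       [set x - 2; x - 1; x; x + 1; x + 2]%R])%E.
Proof.
have hs1 B n g : hit Delta (B \o map id) n g = hit Delta B n (map id g).
  by rewrite map_id; congr hit; apply/funext => h /=; rewrite map_id.
have hs2 := @hit_map_opp R Delta.
split.
  (* Upper bounds for the walk and for its reflection leave finitely many sites. *)
  apply: filterS2 (ae_bounded_above hDelta hX hs1)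
    (ae_bounded_above hDelta hX hs2).
  move=> w [M hM] [M' hM'].
  apply: (sub_finite_set
    (B := (fun k : nat => k%:Z - M') @` `I_(absz (M + M')%R))).
    move=> v /asymptotic_rangeE/(_ 1%N)[n]; rewrite -has_count.
    move=> /hasP[z zt /eqP zv]; rewrite {}zv in zt.
    have [m vE] : exists m, X m w = v.
      elim: n zt => [|n IH] /=; first by rewrite inE => /eqP->; exists 0%N.
      by rewrite inE => /orP[/eqP->|/IH //]; exists n.+1.
    have := hM m; have := hM' m; rewrite /= vE => h1 h2.
    by exists (absz (v + M')); rewrite /=; clear -h1 h2; lia.
  exact/finite_image/finite_II.
move=> x.
have [D HD] := reach_balanced hDelta hX x.
have [N0 HN0] := hit_escape_balanced hDelta D.
have [n0 [g [Pg hg hl hr [hc hr2 hl2 hr3 hl3]]]] := HD N0.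
pose Bp := escape Delta 9 x.
pose Bm := escape Delta 9 (- x) \o map -%R.
have hp K : hit Delta Bp K g <= 9 / 20.
  by apply: (HN0 N0) => //; case/andP: hl.
have hm K : hit Delta Bm K g <= 9 / 20.
  rewrite hs2; apply: (HN0 N0) => //; rewrite ?count_map_opp ?opprD ?opprK //.
  - by rewrite -hg; clear; case: g => //=; rewrite oppr0.
  - by case/andP: hr.
pose ever B := [set w | exists k, B (trace X (n0 + k) w)].
have mever B : measurable (ever B).
  rewrite (_ : ever B = \bigcup_k [set w | B (trace X (n0 + k) w)]).
    by apply: bigcupT_measurable => k; exact: (measurable_trace _ _ (fun g => B g)).
  by apply/seteqP; split=> w [k]; exists k.
have mg := measurable_cyl X n0 g.
(* After [g], each escape has conditional probability at most 9/20, so with at least 1/10 neither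
   occurs. *)
pose S := cyl X n0 g `\` (ever Bp `|` ever Bm).
have mS : measurable S by apply: measurableD => //; exact: measurableU.
have PS : (0 < P S)%E.
  rewrite lt0e measure_ge0 andbT; apply/eqP => S0.
  have uni A C : measurable A -> measurable C -> (P (A `|` C) <= P A + P C)%E.
    exact: measureU2.
  have mp : measurable (cyl X n0 g `&` ever Bp) by exact: measurableI.
  have mm : measurable (cyl X n0 g `&` ever Bm) by exact: measurableI.
  have mpm := measurableU _ _ mp mm.
  have sub : cyl X n0 g `<=`
      S `|` ((cyl X n0 g `&` ever Bp) `|` (cyl X n0 g `&` ever Bm)).
    move=> w gw; have [w1|w1] := pselect (ever Bp w); first by right; left.
    have [w2|w2] := pselect (ever Bm w); first by right; right.
    by left; split=> // -[].
  have le1 := le_measure P (mem_set mg) (mem_set (measurableU _ _ mS mpm)) sub.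
  have le2 := le_trans le1 (uni _ _ mS mpm).
  rewrite S0 add0e in le2.
  have le3 := le_trans le2 (uni _ _ mp mm).
  have le4 : (P (cyl X n0 g) <= (9 / 20)%:E * P (cyl X n0 g)
      + (9 / 20)%:E * P (cyl X n0 g))%E.
    exact: le_trans le3 (leeD (prob_met_ever hDelta hX n0 hp)
      (prob_met_ever hDelta hX n0 hm)).
  move: le4 Pg; rewrite -(@fineK _ (P (cyl X n0 g))) ?fin_num_measure //.
  by rewrite -!EFinM -EFinD lee_fin lte_fin; move: (fine _) => p; lra.
have rangeE (v : int) : x - 2 <= v <= x + 2 <->
    [set x - 2; x - 1; x; x + 1; x + 2] v.
  split=> [hv|]; last by move=> [[[[->|->]|->]|->]|->]; lia.
  have : [|| v == x - 2, v == x - 1, v == x, v == x + 1 | v == x + 2].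
    by clear -hv; lia.
  case/or4P => [/eqP->|/eqP->|/eqP->|/orP[/eqP->|/eqP->]].
  - by do 4 left.
  - by do 3 left; right.
  - by do 2 left; right.
  - by left; right.
  - by right.
set target := [set w | _].
have targetE w : target w <-> forall v, recurrent X w v <-> x - 2 <= v <= x + 2.
  split=> [e v|e].
    split=> [/(asymptotic_rangeE X R)|/rangeE hv].
      by rewrite e => /rangeE.
    by apply/(asymptotic_rangeE X R); rewrite e.
  apply/seteqP; split=> v; first by move=> /asymptotic_rangeE/e/rangeE.
  by move=> /rangeE/e ?; apply/asymptotic_rangeE.
(* Recurrence of a site is a countable intersection of countable unions of path events, and the
   sites are countable. *)
have mtarget : measurable target.
  pose V v := [set w | recurrent X w v].
  have mV v : measurable (V v).
    rewrite (_ : V v = \bigcap_L \bigcup_n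
        [set w | (L <= count_mem v (trace X n w))%N]).
      apply: bigcapT_measurable => L; apply: bigcupT_measurable => n.
      exact: (measurable_trace _ _ (fun g => (L <= count_mem v g)%N)).
    apply/seteqP; split=> w hw L; first by have [n] := hw L; exists n.
    by have [n] := hw L I; exists n.
  rewrite (_ : target = ~` \bigcup_(v : int)
      (if x - 2 <= v <= x + 2 then ~` V v else V v)).
    apply: measurableC; apply: countable_bigcupT_measurable => // v.
    by case: ifP => _ //; exact: measurableC.
  apply/seteqP; split=> w.
    move=> /targetE wt [v _]; have := wt v; case: ifP => _ /= [h1 h2] rv.
      by apply: rv; exact: h2.
    by have := h1 rv.
  move=> wn; apply/targetE => v; split=> [rv|hv]; apply: contrapT => h; apply: wn.
    by exists v => //; rewrite ifF //; apply/negP.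
  by exists v => //; rewrite hv.
have [N [mN PN subN]] := filterI (ae_nearest_neighbour hDelta hX) (filterI
  (ae_not_quiet hDelta hX hs1 x) (ae_not_quiet hDelta hX hs2 (- x))).
suff sub : S `<=` target `|` N.
  apply: lt_le_trans PS _.
  have le1 := le_measure P (mem_set mS) (mem_set (measurableU _ _ mtarget mN)) sub.
  apply: le_trans le1 (le_trans (measureU2 _ mtarget mN) _).
  by rewrite [X in (_ + X)%E]PN adde0.
move=> w [gw nE]; have [wN|wN] := pselect (N w); [by right|left].
have /(contra_notP (@subN w)) [nn [q1 q2]] := wN.
have good k : ~~ Bp (trace X (n0 + k) w) /\ ~~ Bm (trace X (n0 + k) w).
  by split; apply/negP => h; apply: nE; [left|right]; exists k.
have good' n : (n0 <= n)%N -> ~~ Bp (trace X n w) /\ ~~ Bm (trace X n w).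
  by move=> /subnKC <-; exact: good.
apply/targetE; apply: (@recurrent_confined R Delta _ _ w x n0) => //.
(* No escape on either side means [X n < x + 3] and [- X n < - x + 3]. *)
- move=> n /good'[/norP[h1 _] /norP[h2 _]]; move: h1 h2.
  by rewrite -(trace_map X -%R) !head_trace; lia.
- move=> n /good'[/norP[_ h1] /norP[_ h2]]; split; first by rewrite leNgt.
  by move: h2; rewrite !weight_map_opp !opprD !opprK -leNgt.
Qed.
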